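(* Let $T\sim\{X_n\}_{n=1}^{\infty}$ be a random weighted shift on $\mathcal H$ (with $\{X_n\}$ bounded, nonnegative, i.i.d.). Then $$\mathbb P\big(\mathcal K(\mathcal H)\subset C^*(T)\big)=\mathbb P\big(C^*(T)\cap\mathcal K(\mathcal H)\neq\{0\}\big)=\begin{cases}1,& 0\notin\operatorname{essran}X_1,\\ 0,& 0\in\operatorname{essran}X_1.\end{cases}$$
   Context: $\mathcal H$ is a complex separable infinite-dimensional Hilbert space with orthonormal basis $\{e_n\}_{n=1}^\infty$; $\mathcal B(\mathcal H)$ is the algebra of bounded linear operators and $\mathcal K(\mathcal H)$ the ideal of compact operators on $\mathcal H$. $\{X_n\}_{n=1}^\infty$ are nonnegative, bounded, i.i.d. random variables on a probability space $(\Omega,\mathcal F,\mathbb P)$. Writing $T\sim\{X_n\}_{n=1}^\infty$ means that $T=T(\omega)$ is the random unilateral weighted shift $T(\omega)e_n=X_n(\omega)e_{n+1}$, $n\ge1$. $\operatorname{essran}X_1$ is the essential range of $X_1$ (the closed support of its law). $C^*(A)$ is the $C^*$-algebra generated by $A$ and the identity $I$. *)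

(* Defs.v *)
From HB Require Import structures.
From mathcomp Require Import all_boot all_order all_algebra.
From mathcomp Require Import sesquilinear finmap complex.
From mathcomp Require Import all_classical all_reals all_analysis.

Set Implicit Arguments.
Unset Strict Implicit.
Unset Printing Implicit Defensive.

Import Order.TTheory GRing.Theory Num.Theory.
Import numFieldNormedType.Exports.

Local Open Scope classical_set_scope.
Local Open Scope ring_scope.
Local Open Scope complex_scope.

Section Operators.
Context (R : realType) (H : completeNormedModType R[i]).
Context (dot : {dot H for (@Num.conj R[i])}).

(* The norm and topology of [H] are those of the inner product, which is linear
   in its first argument; together with the completeness of [H] this makes
   [(H, dot)] a complex Hilbert space. *)
Definition hilbert_inner_product : Prop :=
  forall x : H, `|x| ^+ 2 = dot x x.

Definition orthonormal_basis (e : nat -> H) : Prop :=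
  (forall i j, dot (e i) (e j) = (i == j)%:R) /\
  (forall x : H, (fun n => \sum_(k < n) dot x (e k) *: e k) @ \oo --> x).

Definition bounded_op : set (H -> H) :=
  [set A | linear A /\ exists M : R, forall x, `|A x| <= M%:C * `|x|].

(* [`|x|] is an element of [R[i]], hence the real part. *)
Definition opnorm (A : H -> H) : R :=
  sup [set complex.Re `|A x| | x in [set x : H | `|x| <= 1]].

Definition is_adjoint (A B : H -> H) : Prop :=
  forall x y, dot (A x) y = dot x (B y).

Definition compact_op : set (H -> H) :=
  [set A | bounded_op A /\ precompact (A @` [set x : H | `|x| <= 1])].

(* Norm-closed *-subalgebras of B(H). Every bounded operator has exactly one
   adjoint, so closure under involution is stated relationally. *)
Definition Cstar_subalgebra (S : set (H -> H)) : Prop :=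
  [/\ S `<=` bounded_op,
      S (fun=> 0),
      forall (a : R[i]) A B, S A -> S B -> S (fun x => a *: A x + B x),
      forall A B, S A -> S B -> S (A \o B) &
      (forall A B, S A -> bounded_op B -> is_adjoint A B -> S B) /\
      (forall (A_ : nat -> H -> H) A, (forall n, S (A_ n)) -> bounded_op A ->
         (fun n => opnorm (fun x => A_ n x - A x)) @ \oo --> (0 : R) -> S A)].

Definition Cstar (A : H -> H) : set (H -> H) :=
  smallest Cstar_subalgebra [set A; idfun].

End Operators.

Arguments bounded_op {R} H.
Arguments compact_op {R} H.

Section Probability.
Context (d : measure_display) (Omega : measurableType d) (R : realType).
Context (P : probability Omega R).

Definition mutually_independent (X : nat -> {RV P >-> R}) : Prop :=
  forall (J : {fset nat}) (B : nat -> set R), (forall n, measurable (B n)) ->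
    P (\bigcap_(n in [set` J]) (X n @^-1` B n)) =
    \big[mule/1%E]_(n <- J) P (X n @^-1` B n).

Definition identically_distributed (X : nat -> {RV P >-> R}) : Prop :=
  forall m n (B : set R), measurable B ->
    distribution P (X m) B = distribution P (X n) B.

Definition essran (X : {RV P >-> R}) : set R :=
  [set t | forall r : R, 0 < r -> (0 < distribution P X (ball t r))%E].

End Probability.

(* The basis and the weights are indexed from 0 instead of 1. *)
Definition random_weighted_shift (R : realType) (H : completeNormedModType R[i])
    (e : nat -> H) (Omega : Type) (X : nat -> Omega -> R)
    (T : Omega -> H -> H) : Prop :=
  forall w, bounded_op H (T w) /\
    forall n, T w (e n) = (X n w)%:C *: e n.+1.

(* Main.v *)
Require Import Defs.
From HB Require Import structures.
From mathcomp Require Import all_boot all_order all_algebra.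
From mathcomp Require Import sesquilinear finmap complex.
From mathcomp Require Import all_classical all_reals all_analysis.
From mathcomp Require Import measurable_realfun ring lra.

Set Implicit Arguments.
Unset Strict Implicit.
Unset Printing Implicit Defensive.

Import Order.TTheory GRing.Theory Num.Theory.
Import numFieldNormedType.Exports.

Local Open Scope classical_set_scope.
Local Open Scope ring_scope.
Local Open Scope complex_scope.

(** The proof splits into a criterion for a single weighted shift [T] with
    weights [x n >= 0], valid for every sample point, and a recurrence argument
    for i.i.d. sequences.

    The operators [T T^*] and [T^*k T^k] are diagonal: their entries at [e n]
    are [x (n-1)^2] (0 for n = 0), written [inweight x n], and
    [x n ^2 ... x (n+k-1) ^2], written [outweight x k n].  At a vertex n
    with vanishing inweight, these numbers determine the action on e n of every
    element of C*(T).  Such a vertex a begins an irreducible component of [T]; it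
    is [isolated] when the data at n, for n large, stay away from the data at a.
    The criterion is that C*(T) contains a nonzero compact operator iff there is
    an isolated vertex ([Cstar_meets_compacts]), and contains all of them iff
    moreover no weight vanishes ([Cstar_contains_compacts]).

    If a is isolated, some diagonal element 1 - c * discrepancy of C*(T) is 1 on
    finitely many basis vectors, e a among them, and lies in [0, rho] with
    rho < 1 on all others, so its powers converge in norm to a nonzero projection
    of finite rank ([isolated_projection]).  If no weight vanishes, only the
    vertex 0 can be isolated, the projection is the one onto e 0, and moving it
    around with T and T^* produces every matrix unit, hence every compact
    operator ([compact_sub_Cstar]).  A vanishing weight x m makes the closed span
    of the e n with n > m reducing, and then some matrix unit is not in C*(T).

    If a is not isolated, there are q 0, q 1, ... tending to infinity at which
    the data converge to those at a.  Every A in C*(T) then acts on T^s (e (q j))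
    asymptotically as on T^s (e a), that is, both images are approximated by
    the same linear combination of the T^k (e (q j)), respectively of the
    T^k (e a) ([Cstar_approx]).  When A is compact, the images of the
    T^s (e (q j)) tend to 0, since these vectors are weakly null; so
    A (T^s (e a)) = 0 ([compact_Cstar_vpath0]).  If no initial vertex of a
    component is isolated, A kills the whole basis.

    As the criteria only involve countably many inequalities between polynomials
    in the weights, both events are measurable.  If 0 is not in the essential
    range, almost surely all weights are at least some r > 0, and the vertex 0 is
    isolated because all other vertices have inweight at least r^2
    ([weights_bounded_below]).  If 0 is in the essential range, consider the
    windows made of a small weight followed by k weights in prescribed small
    intervals.  When these intervals have positive probability, such windows
    occur infinitely often almost surely, by independence; countably many choices
    of intervals of a given length cover all possible weights x a, ..., x (a+k-1),
    so almost surely no vertex is isolated ([isolated_negligible]). *)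

(** * Real-valued norms *)

Section RealNorm.
Context {R : realType}.

(** The norm of a normed module over [R[i]] takes its values in [R[i]]; its real
    part carries the same information and is compared in a total order. *)
Definition nrm {V : normedZmodType R[i]} (x : V) : R := complex.Re `|x|.

Lemma nrmE (V : normedZmodType R[i]) (x : V) : `|x| = (nrm x)%:C.
Proof. by rewrite /nrm RRe_real// normr_real. Qed.

Lemma nrm_ge0 (V : normedZmodType R[i]) (x : V) : 0 <= nrm x.
Proof. by rewrite -ler0c -nrmE. Qed.

Lemma nrm_eq0 (V : normedZmodType R[i]) (x : V) : (nrm x == 0) = (x == 0).
Proof. by rewrite -[RHS]normr_eq0 nrmE; apply/eqP/eqP => [->|[]]. Qed.

Lemma nrm0 (V : normedZmodType R[i]) : nrm (0 : V) = 0.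
Proof. by apply/eqP; rewrite nrm_eq0. Qed.

Lemma nrmN (V : normedZmodType R[i]) (x : V) : nrm (- x) = nrm x.
Proof. by rewrite /nrm normrN. Qed.

Lemma nrmB (V : normedZmodType R[i]) (x y : V) : nrm (x - y) = nrm (y - x).
Proof. by rewrite -nrmN opprB. Qed.

Lemma ler_nrmD (V : normedZmodType R[i]) (x y : V) : nrm (x + y) <= nrm x + nrm y.
Proof. by rewrite -lecR rmorphD /= -!nrmE ler_normD. Qed.

Lemma ler_nrm_dist (V : normedZmodType R[i]) (x y z : V) :
  nrm (x - z) <= nrm (x - y) + nrm (y - z).
Proof. by rewrite (le_trans _ (ler_nrmD _ _))// addrA subrK. Qed.

Lemma nrmZ (V : normedModType R[i]) (a : R[i]) (x : V) :
  nrm (a *: x) = nrm a * nrm x.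
Proof. by apply: complexI; rewrite rmorphM /= -!nrmE normrZ. Qed.

Lemma nrmM (a b : R[i]) : nrm (a * b) = nrm a * nrm b.
Proof. by apply: complexI; rewrite rmorphM /= -!nrmE normrM. Qed.

Lemma nrm_real (r : R) : nrm r%:C = `|r|.
Proof. by rewrite /nrm normc_def /= expr0n addr0 sqrtr_sqr. Qed.

Lemma nrm_conj (a : R[i]) : nrm (Num.conj a) = nrm a.
Proof. by rewrite /nrm norm_conjC. Qed.

Lemma nrm_sqr (a : R[i]) : (nrm a ^+ 2)%:C = a * Num.conj a.
Proof. by rewrite rmorphXn /= -nrmE normCK. Qed.

Lemma cvg_nrmP (V : normedModType R[i]) (u : nat -> V) (l : V) :
  u @ \oo --> l <-> forall eps : R, 0 < eps -> \forall n \near \oo, nrm (l - u n) < eps.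
Proof.
split => [/cvgrPdist_lt ul eps eps0|ul].
  have := ul eps%:C; rewrite ltcR => /(_ eps0); apply: filterS => n.
  by rewrite nrmE ltcR.
apply/cvgrPdist_lt => eps eps0.
have epsE : eps = (complex.Re eps)%:C by rewrite RRe_real// gtr0_real.
move: eps0; rewrite epsE ltcR => /ul; apply: filterS => n.
by rewrite nrmE ltcR.
Qed.

Lemma cvg_nrm_near (V : normedModType R[i]) (u : nat -> V) (l : V) (eps : R) :
  u @ \oo --> l -> 0 < eps -> \forall n \near \oo, nrm (l - u n) < eps.
Proof. by move=> /cvg_nrmP; apply. Qed.

Lemma nrm_lim_le (V : normedModType R[i]) (u : nat -> V) (l : V) (M : R) :
  u @ \oo --> l -> (\forall n \near \oo, nrm (u n) <= M) -> nrm l <= M.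
Proof.
move=> ul uM; apply/ler_addgt0Pr => eps eps0.
near \oo => n.
have h1 : nrm (l - u n) < eps by near: n; exact: cvg_nrm_near.
have h2 : nrm (u n) <= M by near: n.
rewrite -(subrK (u n) l) (le_trans (ler_nrmD _ _))// addrC lerD// ltW//.
Unshelve. all: by end_near. Qed.

Lemma cvg_sum_ord {T : Type} (F : set_system T) {FF : Filter F} n
    (f : nat -> T -> R) (a : nat -> R) : (forall k, (k < n)%N -> f k @ F --> a k) ->
  (fun x => \sum_(k < n) f k x) @ F --> \sum_(k < n) a k.
Proof.
elim: n => [|n IHn] fa.
  by rewrite big_ord0; under eq_fun do rewrite big_ord0; exact: cvg_cst.
rewrite big_ord_recr; under eq_fun do rewrite big_ord_recr.
by apply: cvgD; [apply: IHn => k kn; apply: fa; exact: ltnW|exact: fa].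
Qed.

Lemma cvg_prod_ord {T : Type} (F : set_system T) {FF : Filter F} n
    (f : nat -> T -> R) (a : nat -> R) : (forall k, (k < n)%N -> f k @ F --> a k) ->
  (fun x => \prod_(k < n) f k x) @ F --> \prod_(k < n) a k.
Proof.
elim: n => [|n IHn] fa.
  by rewrite big_ord0; under eq_fun do rewrite big_ord0; exact: cvg_cst.
rewrite big_ord_recr; under eq_fun do rewrite big_ord_recr.
by apply: cvgM; [apply: IHn => k kn; apply: fa; exact: ltnW|exact: fa].
Qed.

End RealNorm.

(** * Hilbert space geometry *)

Section InnerProduct.
Context (R : realType) (H : completeNormedModType R[i]).
Context (dot : {dot H for (@Num.conj R[i])}) (hdot : hilbert_inner_product dot).

Lemma dotDl x y z : dot (x + y) z = dot x z + dot y z.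
Proof. exact: linearDl. Qed.
Lemma dotDr x y z : dot z (x + y) = dot z x + dot z y.
Proof. exact: linearDr. Qed.
Lemma dotBl x y z : dot (x - y) z = dot x z - dot y z.
Proof. exact: linearBl. Qed.
Lemma dotBr x y z : dot z (x - y) = dot z x - dot z y.
Proof. exact: linearBr. Qed.
Lemma dotZl a x z : dot (a *: x) z = a * dot x z.
Proof. exact: linearZl_LR. Qed.
Lemma dotZr a x z : dot z (a *: x) = Num.conj a * dot z x.
Proof. exact: linearZr_LR. Qed.
Lemma dot0l z : dot 0 z = 0.
Proof. exact: linear0l. Qed.
Lemma dot0r z : dot z 0 = 0.
Proof. exact: linear0r. Qed.
Lemma dotC x y : dot x y = Num.conj (dot y x).
Proof. by have := hermC dot x y; rewrite expr0 mul1r. Qed.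
Lemma dot_suml n (F : 'I_n -> H) z :
  dot (\sum_(k < n) F k) z = \sum_(k < n) dot (F k) z.
Proof. exact: linear_sumlz. Qed.
Lemma dot_sumr n (F : 'I_n -> H) z :
  dot z (\sum_(k < n) F k) = \sum_(k < n) dot z (F k).
Proof. exact: linear_sumr. Qed.

Lemma dot_nrm x : dot x x = (nrm x ^+ 2)%:C.
Proof. by rewrite -hdot nrmE rmorphXn. Qed.

Lemma nrm_sqrD x y : dot x y = 0 -> nrm (x + y) ^+ 2 = nrm x ^+ 2 + nrm y ^+ 2.
Proof.
move=> xy; apply: complexI; rewrite rmorphD /= -!dot_nrm dotDl !dotDr xy.
by rewrite (dotC y x) xy rmorph0 addr0 add0r.
Qed.

Lemma Cauchy_Schwarz x y : nrm (dot x y) <= nrm x * nrm y.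
Proof.
have [->|y0] := eqVneq y 0; first by rewrite dot0r !nrm0 mulr0.
have y0' : 0 < nrm y by rewrite lt_neqAle nrm_ge0 eq_sym nrm_eq0 y0.
pose p := (dot x y / dot y y) *: y.
have dyy : dot y y != 0 by rewrite dot_nrm fmorph_eq0 sqrf_eq0 gt_eqF.
have o : dot (x - p) p = 0.
  by rewrite dotZr dotBl dotZl divfK// subrr mulr0.
have /= := nrm_sqrD o; rewrite subrK => E.
have : nrm p ^+ 2 <= nrm x ^+ 2 by rewrite E lerDr sqr_ge0.
rewrite ler_sqr ?nnegrE ?nrm_ge0// nrmZ => h.
move: h; rewrite nrmM.
have -> : nrm (dot y y)^-1 = (nrm y ^+ 2)^-1.
  by rewrite dot_nrm -fmorphV/= nrm_real ger0_norm// invr_ge0 sqr_ge0.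
by rewrite expr2 invfM -!mulrA mulVf ?gt_eqF// mulr1 ler_pdivrMr.
Qed.

End InnerProduct.

Section Basis.
Context (R : realType) (H : completeNormedModType R[i]).
Context (dot : {dot H for (@Num.conj R[i])}) (hdot : hilbert_inner_product dot).
Context (e : nat -> H) (he : orthonormal_basis dot e).

Lemma dot_e i j : dot (e i) (e j) = (i == j)%:R.
Proof. exact: he.1. Qed.

Lemma nrm_e i : nrm (e i) = 1.
Proof.
apply/eqP; rewrite -(@pexpr_eq1 _ _ 2) ?nrm_ge0//; apply/eqP/complexI.
by rewrite -(dot_nrm hdot) dot_e eqxx.
Qed.

Lemma nrm_sum_orth (f : nat -> nat) (c : nat -> R[i]) n : injective f ->
  nrm (\sum_(k < n) c k *: e (f k)) ^+ 2 = \sum_(k < n) nrm (c k) ^+ 2.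
Proof.
move=> finj; elim: n => [|n IHn]; first by rewrite !big_ord0 nrm0 expr0n.
rewrite !big_ord_recr /= (nrm_sqrD hdot) ?IHn ?nrmZ ?nrm_e ?mulr1//.
rewrite dotZr dot_suml big1 ?mulr0// => k _.
by rewrite dotZl dot_e (inj_eq finj) ltn_eqF ?mulr0.
Qed.

Definition projn n (x : H) := \sum_(k < n) dot x (e k) *: e k.

Lemma dot_sum_e (c : nat -> R[i]) n k :
  dot (\sum_(i < n) c i *: e i) (e k) = if (k < n)%N then c k else 0.
Proof.
elim: n => [|n IHn]; first by rewrite big_ord0 dot0l.
rewrite big_ord_recr/= dotDl IHn dotZl dot_e ltnS.
by case: (ltngtP k n) => [_|_|->]; rewrite /= ?mulr0 ?mulr1 ?addr0 ?add0r.
Qed.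

Lemma dot_proj n x k : dot (projn n x) (e k) = if (k < n)%N then dot x (e k) else 0.
Proof. exact: (dot_sum_e (fun k => dot x (e k))). Qed.

Lemma proj_is_linear n a x y : projn n (a *: x + y) = a *: projn n x + projn n y.
Proof.
rewrite /projn scaler_sumr -big_split; apply: eq_bigr => k _ /=.
by rewrite dotDl dotZl scalerDl scalerA.
Qed.

Lemma projnZ n a x : projn n (a *: x) = a *: projn n x.
Proof. by rewrite /projn scaler_sumr; apply: eq_bigr => k _; rewrite dotZl scalerA. Qed.

Lemma projn0 n : projn n 0 = 0.
Proof. by rewrite -(scale0r (0 : H)) projnZ !scale0r. Qed.

Lemma projB n x y : projn n (x - y) = projn n x - projn n y.
Proof. by rewrite addrC -scaleN1r proj_is_linear scaleN1r addrC. Qed.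

Lemma nrm_proj_sum n x : nrm (projn n x) ^+ 2 = \sum_(k < n) nrm (dot x (e k)) ^+ 2.
Proof. exact: (nrm_sum_orth (fun k => dot x (e k)) n (@inj_id _)). Qed.

Lemma nrm_sqr_proj n x : nrm x ^+ 2 = nrm (projn n x) ^+ 2 + nrm (x - projn n x) ^+ 2.
Proof.
have o : dot (projn n x) (x - projn n x) = 0.
  rewrite {1}/projn dot_suml big1// => k _.
  by rewrite dotZl (dotC _ (e k)) dotBl dot_proj ltn_ord subrr rmorph0 mulr0.
by rewrite -(nrm_sqrD hdot o) addrC subrK.
Qed.

Lemma nrm_proj_le n x : nrm (projn n x) <= nrm x.
Proof.
rewrite -ler_sqr ?nnegrE ?nrm_ge0// (nrm_sqr_proj n x) lerDl sqr_ge0//.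
Qed.

Lemma nrm_tail_le n x : nrm (x - projn n x) <= nrm x.
Proof.
rewrite -ler_sqr ?nnegrE ?nrm_ge0// (nrm_sqr_proj n x) lerDr sqr_ge0//.
Qed.

Lemma cvg_proj x : (fun n => projn n x) @ \oo --> x.
Proof. exact: he.2. Qed.

Lemma eq_coord x y : (forall k, dot x (e k) = dot y (e k)) -> x = y.
Proof.
move=> xy; have projE n : projn n x = projn n y by apply: eq_bigr => k _; rewrite xy.
have px : (fun n => projn n y) @ \oo --> x.
  have <- : (fun n => projn n x) = (fun n => projn n y) by exact/funext.
  exact: cvg_proj.
by apply: (cvg_unique _ px (@cvg_proj y)); exact: norm_hausdorff.
Qed.

Lemma nrm_le_coord (M : R) x y : 0 <= M ->
  (forall k, nrm (dot x (e k)) <= M * nrm (dot y (e k))) -> nrm x <= M * nrm y.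
Proof.
move=> M0 xy; apply: nrm_lim_le (@cvg_proj x) _; apply: nearW => n.
apply: (@le_trans _ _ (M * nrm (projn n y))); last first.
  by rewrite ler_wpM2l// nrm_proj_le.
rewrite -ler_sqr ?nnegrE ?mulr_ge0 ?nrm_ge0// exprMn !nrm_proj_sum mulr_sumr.
apply: ler_sum => k _; rewrite -exprMn ler_sqr ?nnegrE ?mulr_ge0 ?nrm_ge0//.
Qed.

(** Orthogonality turns the increments of the partial sums into increments of
    the convergent scalar series, so the partial sums are Cauchy. *)
Lemma Riesz_Fischer (c : nat -> R[i]) (M : R) : 0 <= M ->
  (forall n, \sum_(k < n) nrm (c k) ^+ 2 <= M ^+ 2) ->
  exists x, nrm x <= M /\ forall k, dot x (e k) = c k.
Proof.
move=> M0 cM; pose s n := \sum_(k < n) c k *: e k.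
pose t n := \sum_(k < n) nrm (c k) ^+ 2.
have st m n : (m <= n)%N -> nrm (s n - s m) ^+ 2 = t n - t m.
  move=> mn; rewrite /s /t -(subnKC mn) !big_split_ord /= !(addrC (\sum_(i < m) _)) !addrK.
  under eq_bigr do rewrite addnC.
  under [RHS]eq_bigr do rewrite addnC.
  by rewrite (@nrm_sum_orth (addn^~ m) (fun k => c (k + m)%N)) => // i j /addIn.
have tmono : nondecreasing_seq t.
  by move=> m n mn; rewrite -subr_ge0 -st// sqr_ge0.
have tcvg : cvgn t.
  apply: nondecreasing_is_cvgn => //; exists (M ^+ 2) => _ [n _ <-]; exact: cM.
have scvg : cvg (s @ \oo).
  apply/cauchy_cvgP/cauchy_exP => eps eps0.
  have epsE : eps = (complex.Re eps)%:C by rewrite RRe_real// gtr0_real.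
  move: eps0; rewrite epsE ltcR => eps0.
  have /cvgrPdist_lt/(_ _ (exprn_gt0 2 eps0))[N _ hN] := tcvg.
  exists (s N); exists N => // n /= Nn.
  rewrite -ball_normE/= nrmE ltcR nrmB.
  rewrite -ltr_sqr ?nnegrE ?nrm_ge0 ?ltW// st//.
  apply: le_lt_trans (hN N (leqnn _)); rewrite ger0_norm.
    by rewrite lerD2r; exact: nondecreasing_cvgn_le.
  by rewrite subr_ge0; exact: nondecreasing_cvgn_le.
exists (lim (s @ \oo)); split.
  apply: nrm_lim_le scvg _; apply: nearW => n.
  rewrite -ler_sqr ?nnegrE ?nrm_ge0//.
  by rewrite (@nrm_sum_orth id c n (@inj_id _)).
move=> k; apply/eqP; rewrite -subr_eq0 -nrm_eq0.
apply/eqP/le_anti; rewrite nrm_ge0 andbT; apply/ler_addgt0Pr => eps eps0.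
rewrite add0r.
near \oo => n.
have kn : (k < n)%N by near: n; exact: nbhs_infty_gt.
have h : nrm (lim (s @ \oo) - s n) < eps by near: n; exact: cvg_nrm_near.
have <- : dot (s n) (e k) = c k by rewrite (@dot_sum_e c) kn.
rewrite -dotBl (le_trans (Cauchy_Schwarz hdot _ _))// nrm_e mulr1 ltW//.
Unshelve. all: by end_near. Qed.

End Basis.

(** * Bounded operators and adjoints *)

Section BoundedOperators.
Context (R : realType) (H : completeNormedModType R[i]).
Implicit Types (A B : H -> H).

Lemma linP A a x y : linear A -> A (a *: x + y) = a *: A x + A y.
Proof. by move=> lA; exact: lA. Qed.

Lemma lin0 A : linear A -> A 0 = 0.
Proof. by move=> lA; have := linP (-1) 0 0 lA; rewrite scaler0 addr0 scaleN1r addNr. Qed.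

Lemma linZ A a x : linear A -> A (a *: x) = a *: A x.
Proof. by move=> lA; have := linP a x 0 lA; rewrite (lin0 lA) !addr0. Qed.

Lemma linD A x y : linear A -> A (x + y) = A x + A y.
Proof. by move=> lA; have := linP 1 x y lA; rewrite !scale1r. Qed.

Lemma linB A x y : linear A -> A (x - y) = A x - A y.
Proof. by move=> lA; rewrite (linD _ _ lA) -scaleN1r (linZ _ _ lA) scaleN1r. Qed.

Lemma lin_sum A n (F : 'I_n -> H) : linear A ->
  A (\sum_(k < n) F k) = \sum_(k < n) A (F k).
Proof.
move=> lA; elim: n F => [|n IHn] F; first by rewrite !big_ord0 (lin0 lA).
by rewrite !big_ord_recr (linD _ _ lA) IHn.
Qed.

Lemma bounded_opP A : bounded_op H A <->
  linear A /\ exists2 M : R, 0 <= M & forall x, nrm (A x) <= M * nrm x.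
Proof.
split=> -[lA [M]].
  move=> AM; split=> //; exists `|M| => // x.
  have := AM x; rewrite !nrmE -rmorphM lecR => /le_trans; apply.
  by rewrite ler_wpM2r ?nrm_ge0// ler_norm.
by move=> _ AM; split=> //; exists M => x; rewrite !nrmE -rmorphM lecR.
Qed.

Lemma bounded_linear A : bounded_op H A -> linear A.
Proof. by case. Qed.

Lemma bounded_op0 : bounded_op H (fun=> 0).
Proof.
apply/bounded_opP; split=> [a x y|]; first by rewrite scaler0 addr0.
by exists 0 => // x; rewrite nrm0 mul0r.
Qed.

Lemma bounded_op_id : bounded_op H idfun.
Proof. by apply/bounded_opP; split=> //; exists 1 => // x; rewrite mul1r. Qed.

Lemma bounded_op_comb a A B : bounded_op H A -> bounded_op H B ->
  bounded_op H (fun x => a *: A x + B x).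
Proof.
move=> /bounded_opP[lA [M M0 AM]] /bounded_opP[lB [N N0 BN]]; apply/bounded_opP.
split=> [c x y|].
  by rewrite (linP _ _ _ lA) (linP _ _ _ lB) !scalerDr !scalerA addrACA (mulrC a).
exists (nrm a * M + N); first by rewrite addr_ge0// mulr_ge0// nrm_ge0.
move=> x; rewrite (le_trans (ler_nrmD _ _))// mulrDl lerD// nrmZ -mulrA.
by rewrite ler_wpM2l ?nrm_ge0.
Qed.

Lemma bounded_op_comp A B : bounded_op H A -> bounded_op H B ->
  bounded_op H (A \o B).
Proof.
move=> /bounded_opP[lA [M M0 AM]] /bounded_opP[lB [N N0 BN]]; apply/bounded_opP.
split=> [c x y|]; first by rewrite /= (linP _ _ _ lB) (linP _ _ _ lA).
exists (M * N); first by rewrite mulr_ge0.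
move=> x /=; rewrite (le_trans (AM _))// -mulrA ler_wpM2l//.
Qed.

Lemma bounded_opB A B : bounded_op H A -> bounded_op H B ->
  bounded_op H (fun x => A x - B x).
Proof.
move=> bA bB; have := bounded_op_comb (-1) bB bA.
by congr bounded_op; apply/funext => x; rewrite scaleN1r addrC.
Qed.

Lemma opnorm_le A (M : R) : 0 <= M -> (forall x, nrm (A x) <= M * nrm x) ->
  opnorm A <= M.
Proof.
move=> M0 AM; apply: ge_sup.
  by exists (nrm (A 0)), 0 => //=; rewrite normr0.
move=> _ [x /= x1 <-]; rewrite -[X in X <= _]/(nrm (A x)) (le_trans (AM x))//.
by rewrite ler_piMr// -lecR -nrmE.
Qed.

Lemma opnorm_ge0 A : bounded_op H A -> 0 <= opnorm A.
Proof.
move=> /bounded_opP[lA [M M0 AM]].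
apply: (@le_trans _ _ (nrm (A 0))); first exact: nrm_ge0.
apply: ub_le_sup; last by exists 0 => //=; rewrite normr0.
exists M => _ [x /= x1 <-]; rewrite -[X in X <= _]/(nrm (A x)) (le_trans (AM x))//.
by rewrite ler_piMr// -lecR -nrmE.
Qed.

Lemma le_opnorm A x : bounded_op H A -> nrm (A x) <= opnorm A * nrm x.
Proof.
move=> /[dup] bA /bounded_opP[lA [M M0 AM]].
have [->|x0] := eqVneq x 0; first by rewrite (lin0 lA) !nrm0 mulr0.
have x0' : 0 < nrm x by rewrite lt_neqAle nrm_ge0 eq_sym nrm_eq0 x0.
rewrite -ler_pdivrMr// mulrC.
have -> : (nrm x)^-1 * nrm (A x) = nrm (A ((nrm x)^-1%:C *: x)).
  by rewrite (linZ _ _ lA) nrmZ nrm_real ger0_norm// invr_ge0 ltW.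
apply: ub_le_sup.
  exists M => _ [y /= y1 <-]; rewrite -[X in X <= _]/(nrm (A y)) (le_trans (AM y))//.
  by rewrite ler_piMr// -lecR -nrmE.
exists ((nrm x)^-1%:C *: x) => //=.
by rewrite nrmE nrmZ nrm_real ger0_norm ?invr_ge0 ?(ltW x0')// mulVf ?gt_eqF.
Qed.

Lemma opnorm_cvg0 (A_ : nat -> H -> H) (m : nat -> R) :
  (forall n, bounded_op H (A_ n)) ->
  (forall n, 0 <= m n) -> (forall n x, nrm (A_ n x) <= m n * nrm x) ->
  m @ \oo --> (0 : R) -> (fun n => opnorm (A_ n)) @ \oo --> (0 : R).
Proof.
move=> bA m0 Am; apply: squeeze_cvgr (cvg_cst 0) => //; apply: nearW => n.
by rewrite opnorm_ge0//= opnorm_le.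
Qed.

End BoundedOperators.

Section Adjoints.
Context (R : realType) (H : completeNormedModType R[i]).
Context (dot : {dot H for (@Num.conj R[i])}) (hdot : hilbert_inner_product dot).
Context (e : nat -> H) (he : orthonormal_basis dot e).
Implicit Types (A B : H -> H).

Lemma is_adjoint_sym A B : is_adjoint dot A B -> is_adjoint dot B A.
Proof. by move=> AB x y; rewrite dotC -AB -dotC. Qed.

Lemma is_adjoint_unique A B B' : is_adjoint dot A B -> is_adjoint dot A B' -> B = B'.
Proof.
move=> AB AB'; apply/funext => x; apply: (eq_coord he) => k.
by rewrite dotC -AB AB' -dotC.
Qed.

Lemma is_adjoint_comb a A A' B B' : is_adjoint dot A A' -> is_adjoint dot B B' ->
  is_adjoint dot (fun x => a *: A x + B x) (fun x => Num.conj a *: A' x + B' x).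
Proof.
by move=> AA BB x y; rewrite dotDl dotZl AA BB dotDr dotZr conjCK.
Qed.

Lemma is_adjoint_comp A A' B B' : is_adjoint dot A A' -> is_adjoint dot B B' ->
  is_adjoint dot (A \o B) (B' \o A').
Proof. by move=> AA BB x y; rewrite /= AA BB. Qed.

(** The way identities between bounded operators are extended from finite
    linear combinations of the basis to all vectors. *)
Lemma eq0_tail (V : normedModType R[i]) (z : V) (C : R) x : 0 <= C ->
  (forall n, nrm z <= C * nrm (x - projn dot e n x)) -> z = 0.
Proof.
move=> C0 zC; apply/eqP; rewrite -nrm_eq0.
apply/eqP/le_anti; rewrite nrm_ge0 andbT; apply/ler_addgt0Pr => eps eps0.
rewrite add0r; near \oo => n.
have h : nrm (x - projn dot e n x) < eps / (C + 1).
  near: n; apply: cvg_nrm_near; [exact: (cvg_proj he)|rewrite divr_gt0// ltr_wpDl//].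
rewrite (le_trans (zC n))// (le_trans (ler_wpM2l C0 (ltW h)))//.
rewrite mulrCA ler_piMr//; first exact: ltW.
by rewrite ler_pdivrMr ?ltr_wpDl// mul1r lerDl.
Unshelve. all: by end_near. Qed.

Lemma op_ext A B : bounded_op H A -> bounded_op H B ->
  (forall k, A (e k) = B (e k)) -> A = B.
Proof.
move=> bA bB AB; apply/funext => x; apply/eqP; rewrite -subr_eq0; apply/eqP.
have /bounded_opP[lC [M M0 CM]] := bounded_opB bA bB.
apply: (eq0_tail (x := x) M0) => n; rewrite (le_trans _ (CM _))//.
have C0 : A (projn dot e n x) - B (projn dot e n x) = 0.
  rewrite /projn (lin_sum _ (bounded_linear bA)) (lin_sum _ (bounded_linear bB)).
  rewrite -sumrB big1// => k _.
  by rewrite (linZ _ _ (bounded_linear bA)) (linZ _ _ (bounded_linear bB)) AB subrr.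
by rewrite [X in _ <= nrm X](linB x _ lC) /= C0 subr0.
Qed.

(** Testing the functional [x |-> dot (A x) y] on the vector whose coordinates
    are the conjugates of its own first [n] values gives [s <= M * nrm y * sqrt s]
    for the sum [s]. *)
Lemma sum_sqr_dot_le A (M : R) y n : linear A -> 0 <= M ->
  (forall x, nrm (A x) <= M * nrm x) ->
  \sum_(k < n) nrm (dot (A (e k)) y) ^+ 2 <= (M * nrm y) ^+ 2.
Proof.
move=> lA M0 AM; set s := \sum_(k < n) _.
have s0 : 0 <= s by apply: sumr_ge0 => k _; exact: sqr_ge0.
(* At [z] the functional takes the value [s], and [nrm z ^+ 2 = s]. *)
pose z := \sum_(k < n) Num.conj (dot (A (e k)) y) *: e k.
have zs : nrm z ^+ 2 = s.
  rewrite (nrm_sum_orth hdot he (fun k => Num.conj (dot (A (e k)) y)) n (@inj_id _)).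
  by apply: eq_bigr => k _; rewrite nrm_conj.
have : nrm (dot (A z) y) <= M * nrm z * nrm y.
  by rewrite (le_trans (Cauchy_Schwarz hdot _ _))// ler_wpM2r ?nrm_ge0.
have -> : dot (A z) y = s%:C.
  rewrite (lin_sum _ lA) dot_suml rmorph_sum; apply: eq_bigr => k _ /=.
  by rewrite (linZ _ _ lA) dotZl nrm_sqr mulrC.
rewrite nrm_real ger0_norm// -zs mulrAC expr2.
have [->|z0] := eqVneq (nrm z) 0; first by rewrite mul0r sqr_ge0.
have z0' : 0 < nrm z by rewrite lt_neqAle nrm_ge0 eq_sym z0.
by rewrite ler_pM2r// => h; rewrite -expr2 ler_sqr ?nnegrE ?mulr_ge0 ?nrm_ge0.
Qed.

(** The coordinates of the adjoint at [y] are forced; they are square-summable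
    by [sum_sqr_dot_le], and [Riesz_Fischer] assembles them. *)
Lemma adjoint_exists A : bounded_op H A ->
  exists2 B, bounded_op H B & is_adjoint dot A B.
Proof.
move=> /[dup] bA /bounded_opP[lA [M M0 AM]].
have /choice[B hB] : forall y, exists x, nrm x <= M * nrm y /\
    forall k, dot x (e k) = Num.conj (dot (A (e k)) y).
  move=> y; apply: (Riesz_Fischer hdot he); first by rewrite mulr_ge0 ?nrm_ge0.
  move=> n; under eq_bigr do rewrite nrm_conj.
  exact: sum_sqr_dot_le.
have lB : linear B.
  move=> a x y; apply: (eq_coord he) => k.
  by rewrite dotDl dotZl !(hB _).2 dotDr dotZr rmorphD rmorphM /= conjCK.
have bB : bounded_op H B.
  by apply/bounded_opP; split=> //; exists M => // y; exact: (hB y).1.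
exists B => // x y.
have dAB n : dot (A (projn dot e n x)) y = dot (projn dot e n x) (B y).
  rewrite (lin_sum _ lA) !dot_suml; apply: eq_bigr => k _.
  by rewrite (linZ _ _ lA) !dotZl (dotC _ (e k)) (hB y).2 conjCK.
apply/eqP; rewrite -subr_eq0; apply/eqP.
apply: (eq0_tail (V := R[i]^o) (C := M * nrm y + M * nrm y) (x := x)) => [|n].
  by rewrite addr_ge0// mulr_ge0// nrm_ge0.
have -> : dot (A x) y - dot x (B y) =
    dot (A (x - projn dot e n x)) y - dot (x - projn dot e n x) (B y).
  by rewrite (linB _ _ lA) !dotBl dAB opprB addrA subrK.
rewrite (le_trans (ler_nrmD _ _))// nrmN mulrDl lerD//.
  rewrite (le_trans (Cauchy_Schwarz hdot _ _))// mulrAC ler_wpM2r ?nrm_ge0//.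
rewrite (le_trans (Cauchy_Schwarz hdot _ _))// mulrC ler_wpM2r ?nrm_ge0//.
exact: (hB y).1.
Qed.

(** Coordinatewise comparison, since [A] multiplies the [k]-th coordinate by
    [a k]. *)
Lemma diagonal_bound A (a : nat -> R[i]) (M : R) x : bounded_op H A -> 0 <= M ->
  (forall k, A (e k) = a k *: e k) -> (forall k, nrm (a k) <= M) ->
  nrm (A x) <= M * nrm x.
Proof.
move=> bA M0 Aa aM; apply: (nrm_le_coord hdot he M0) => k.
have [B bB AB] := adjoint_exists bA.
have -> : dot (A x) (e k) = a k * dot x (e k).
  rewrite AB; have -> : B (e k) = Num.conj (a k) *: e k.
    apply: (eq_coord he) => j; rewrite dotC -AB Aa !dotZl (dot_e he).
    rewrite (dot_e he) eq_sym rmorphM /= rmorph_nat.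
    by case: eqVneq => [->|]; rewrite // !mulr0.
  by rewrite dotZr conjCK.
by rewrite nrmM ler_wpM2r// nrm_ge0.
Qed.

End Adjoints.

(** * Compact operators *)

Section CompactOperators.
Context (R : realType) (H : completeNormedModType R[i]).
Context (dot : {dot H for (@Num.conj R[i])}) (hdot : hilbert_inner_product dot).
Context (e : nat -> H) (he : orthonormal_basis dot e).
Implicit Types (A B K : H -> H).

Lemma precompact_sub_compact (C D : set H) : compact D -> C `<=` D -> precompact C.
Proof.
move=> cD /precompact_subset; apply; rewrite precompact_closed//.
exact: (compact_closed (@norm_hausdorff _ _)).
Qed.

Lemma compact_opD A B : compact_op H A -> compact_op H B ->
  compact_op H (fun x => A x + B x).
Proof.
move=> [bA cA] [bB cB]; split.
  by have := bounded_op_comb 1 bA bB; under eq_fun do rewrite scale1r.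
rewrite precompactE in cA; rewrite precompactE in cB.
apply: (@precompact_sub_compact _ ((fun p : H * H => p.1 + p.2) @`
   (closure (A @` [set x : H | `|x| <= 1]) `*` closure (B @` [set x : H | `|x| <= 1])))).
  apply: continuous_compact; last exact: compact_setX.
  by apply: continuous_subspaceT => p; exact: add_continuous.
move=> _ [x x1 <-]; exists (A x, B x) => //=.
by split; apply: subset_closure; exists x.
Qed.

Lemma continuous_scale_complex (v : H) :
  continuous (fun p : R * R => (p.1 +i* p.2) *: v).
Proof.
move=> p; apply/cvgrPdist_lt => eps eps0.
have epsE : eps = (complex.Re eps)%:C by rewrite RRe_real// gtr0_real.
move: eps0; rewrite epsE ltcR; move: (complex.Re eps) => {epsE}eps eps0.
(* The [+ 1] covers the case [v = 0]. *)
pose dl := eps / (2 * (nrm v + 1)).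
have v1 : 0 < nrm v + 1 by rewrite ltr_wpDl ?nrm_ge0.
have dl0 : 0 < dl by rewrite divr_gt0 ?mulr_gt0.
near=> q.
have h1 : `|p.1 - q.1| < dl.
  near: q; have /cvgrPdist_lt/(_ _ dl0) : (fun q : R * R => q.1) @ nbhs p --> p.1 by exact: cvg_fst.
  exact.
have h2 : `|p.2 - q.2| < dl.
  near: q; have /cvgrPdist_lt/(_ _ dl0) : (fun q : R * R => q.2) @ nbhs p --> p.2 by exact: cvg_snd.
  exact.
rewrite -scalerBl nrmE ltcR nrmZ.
have -> : p.1 +i* p.2 - (q.1 +i* q.2) =
   (p.1 - q.1)%:C + (p.2 - q.2)%:C * 'i%C :> R[i].
  by apply/eqP; rewrite eq_complex /=; apply/andP; split; apply/eqP; ring.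
have h3 : nrm ((p.1 - q.1)%:C + (p.2 - q.2)%:C * 'i%C) <= dl + dl.
  rewrite (le_trans (ler_nrmD _ _))// nrmM !nrm_real.
  have -> : nrm ('i%C : R[i]) = 1.
    by rewrite /nrm normc_def /= expr0n expr1n add0r sqrtr1.
  by rewrite mulr1 lerD// ltW.
apply: (@le_lt_trans _ _ ((dl + dl) * nrm v)); first by rewrite ler_wpM2r ?nrm_ge0.
have -> : (dl + dl) = eps / (nrm v + 1).
  by rewrite /dl invfM; field; rewrite gt_eqF.
by rewrite -mulrA gtr_pMr// mulrC ltr_pdivrMr// mul1r ltrDl.
Unshelve. all: by end_near. Qed.

(** The unit ball is sent into the image of a square of scalars under the
    continuous map [c |-> c *: v]. *)
Lemma compact_rank_one (u v : H) : compact_op H (fun x => dot x u *: v).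
Proof.
split.
  apply/bounded_opP; split=> [a x y|]; first by rewrite dotDl dotZl scalerDl scalerA.
  exists (nrm u * nrm v) => [|x]; first by rewrite mulr_ge0 ?nrm_ge0.
  rewrite nrmZ mulrC (mulrC (nrm u)) -mulrA ler_wpM2l ?nrm_ge0// mulrC.
  exact: Cauchy_Schwarz.
pose I : set R := `[- nrm u, nrm u]%classic.
apply: (@precompact_sub_compact _ ((fun p : R * R => (p.1 +i* p.2) *: v) @` (I `*` I))).
  apply: continuous_compact; last by apply: compact_setX; exact: segment_compact.
  by apply: continuous_subspaceT; exact: continuous_scale_complex.
move=> _ [x /= x1 <-]; exists (complex.Re (dot x u), complex.Im (dot x u)).
  have xu : nrm (dot x u) <= nrm u.
    rewrite (le_trans (Cauchy_Schwarz hdot _ _))// ler_piMl ?nrm_ge0//.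
    by rewrite -lecR -nrmE.
  have N : nrm (dot x u) = Num.sqrt (complex.Re (dot x u) ^+ 2 + complex.Im (dot x u) ^+ 2).
    by rewrite /nrm normc_def.
  have rI (r s : R) : nrm (dot x u) = Num.sqrt (r ^+ 2 + s ^+ 2) -> I r.
    rewrite /I /= in_itv /= -ler_norml => E; apply: le_trans xu.
    by rewrite E -sqrtr_sqr ler_sqrt ?addr_ge0 ?sqr_ge0// lerDl sqr_ge0.
  by split; apply: rI; [exact: N|rewrite /= addrC; exact: N].
by case: (dot x u).
Qed.

Lemma compact_op0 : compact_op H (fun=> 0).
Proof.
have := compact_rank_one 0 0; congr compact_op.
by apply/funext => x; rewrite scaler0.
Qed.

Lemma compact_op_sum n (F : nat -> H -> H) : (forall k, compact_op H (F k)) ->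
  compact_op H (fun x => \sum_(k < n) F k x).
Proof.
move=> cF; elim: n => [|n IHn].
  by under eq_fun do rewrite big_ord0; exact: compact_op0.
by under eq_fun do rewrite big_ord_recr/=; exact: compact_opD.
Qed.

(** The coordinate projections are contractions converging pointwise to the
    identity, hence uniformly on the compact closure of the image of the unit
    ball. *)
Lemma compact_tail K (eps : R) : compact_op H K -> 0 < eps ->
  \forall n \near \oo, forall x, nrm (K x - projn dot e n (K x)) <= eps * nrm x.
Proof.
move=> [bK]; rewrite precompactE => /compact_near_coveringP cK eps0.
have cov : \forall n \near \oo, closure (K @` [set x : H | `|x| <= 1]) `<=`
    (fun y => nrm (y - projn dot e n y) <= eps).
  apply: cK => y _.
  have e2 : 0 < eps / 2 by rewrite divr_gt0.
  near=> z n => /=.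
  have zy : nrm (z - y) <= eps / 2.
    near: z; apply/nbhs_ballP; exists (eps / 2)%:C; first by rewrite /= ltcR.
    by move=> z; rewrite -ball_normE /= nrmE ltcR nrmB => /ltW.
  have yn : nrm (y - projn dot e n y) < eps / 2.
    near: n; apply: cvg_nrm_near; [exact: (cvg_proj he)|exact: e2].
  have -> : z - projn dot e n z = (z - y - projn dot e n (z - y)) + (y - projn dot e n y).
    by rewrite projB opprD opprK addrACA subrK addrK.
  rewrite (splitr eps) (le_trans (ler_nrmD _ _))// lerD//; last exact: ltW.
  by rewrite (le_trans (nrm_tail_le hdot he _ _)).
apply: filterS cov => n cov x.
have lK := bounded_linear bK.
have [->|x0] := eqVneq x 0.
  by rewrite (lin0 lK) projn0 subrr nrm0 mulr_ge0 ?nrm_ge0// ltW.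
have x0' : 0 < nrm x by rewrite lt_neqAle nrm_ge0 eq_sym nrm_eq0 x0.
pose y := (nrm x)^-1%:C *: x.
have xE : x = (nrm x)%:C *: y.
  by rewrite scalerA -rmorphM /= divff ?gt_eqF// scale1r.
rewrite {1 2}xE (linZ _ _ lK) projnZ -scalerBr nrmZ nrm_real ger0_norm ?nrm_ge0//.
rewrite mulrC ler_wpM2r ?nrm_ge0//; apply: cov; apply: subset_closure.
exists y => //=; rewrite nrmE /y nrmZ nrm_real ger0_norm ?invr_ge0 ?nrm_ge0//.
by rewrite mulVf ?gt_eqF.
Unshelve. all: by end_near. Qed.

Lemma dot_op_e_cvg0 A y : bounded_op H A ->
  (fun n => nrm (dot (A (e n)) y) ^+ 2) @ \oo --> (0 : R).
Proof.
move=> /bounded_opP[lA [M M0 AM]].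
apply: cvg_series_cvg_0; apply: nondecreasing_is_cvgn.
  by apply: nondecreasing_series => n _ _; exact: sqr_ge0.
exists ((M * nrm y) ^+ 2) => _ [n _ <-].
by rewrite seriesEord; exact: (sum_sqr_dot_le hdot he).
Qed.

(** Up to [eps / 2], [K (e n)] lies in a fixed finite-dimensional coordinate
    space, by [compact_tail], and each of its coordinates there tends to 0 by
    [dot_op_e_cvg0]. *)
Lemma compact_e_small K (eps : R) : compact_op H K -> 0 < eps ->
  \forall n \near \oo, nrm (K (e n)) < eps.
Proof.
move=> cK eps0.
have e2 : 0 < eps / 2 by rewrite divr_gt0.
have [N _ /(_ N (leqnn _)) /= tailN] := compact_tail cK e2.
have pK : (fun n => \sum_(k < N) nrm (dot (K (e n)) (e k)) ^+ 2) @ \oo --> (0 : R).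
  rewrite [X in _ --> X](_ : _ = \sum_(k < N) 0); last by rewrite big1.
  apply: (cvg_sum_ord (f := fun k n => nrm (dot (K (e n)) (e k)) ^+ 2) (a := fun=> 0)).
  by move=> k _; exact: dot_op_e_cvg0 cK.1.
have /cvgrPdist_lt/(_ _ (exprn_gt0 2 e2)) := pK; apply: filterS => n.
rewrite sub0r normrN ger0_norm; last by apply: sumr_ge0 => k _; exact: sqr_ge0.
rewrite -(nrm_proj_sum hdot he) ltr_sqr ?nnegrE ?nrm_ge0 ?(ltW e2)// => h.
rewrite -(subrK (projn dot e N (K (e n))) (K (e n))) (le_lt_trans (ler_nrmD _ _))//.
rewrite (splitr eps) ler_ltD// (le_trans (tailN _))// (nrm_e hdot he) mulr1//.
Qed.

End CompactOperators.

(** * C*-subalgebras *)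

Section CstarAlgebras.
Context (R : realType) (H : completeNormedModType R[i]).
Context (dot : {dot H for (@Num.conj R[i])}) (hdot : hilbert_inner_product dot).
Context (e : nat -> H) (he : orthonormal_basis dot e).
Implicit Types (A B : H -> H) (S G : set (H -> H)).

Lemma bounded_op_Cstar_subalgebra : Cstar_subalgebra dot (bounded_op H).
Proof.
split; [by []|exact: bounded_op0|exact: bounded_op_comb|exact: bounded_op_comp|].
by split.
Qed.

Lemma Cstar_is_subalgebra A : bounded_op H A -> Cstar_subalgebra dot (Cstar dot A).
Proof.
move=> bA.
have sub S : Cstar_subalgebra dot S -> [set A; idfun] `<=` S -> Cstar dot A `<=` S.
  by move=> hS AS B; apply.
split.
- apply: sub; first exact: bounded_op_Cstar_subalgebra.
  by move=> _ [->|->] //; exact: bounded_op_id.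
- by move=> S [[]].
- move=> a B C BS CS S hS; case: (hS) => [[_ _ cl _ _] _].
  by apply: cl; [exact: BS hS|exact: CS hS].
- move=> B C BS CS S hS; case: (hS) => [[_ _ _ cl _] _].
  by apply: cl; [exact: BS hS|exact: CS hS].
- split.
    move=> B C BS bC BC S hS; case: (hS) => [[_ _ _ _ [cl _]] _].
    by apply: cl bC BC; exact: BS hS.
  move=> B_ B BS bB lim S hS; case: (hS) => [[_ _ _ _ [_ cl]] _].
  by apply: cl bB lim => n; exact: BS hS.
Qed.

Lemma Cstar_self A : Cstar dot A A.
Proof. by move=> S [_]; apply; left. Qed.

Lemma Cstar_id A : Cstar dot A idfun.
Proof. by move=> S [_]; apply; right. Qed.

Lemma opnorm_adjoint_le A B : bounded_op H A -> bounded_op H B ->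
  is_adjoint dot A B -> opnorm B <= opnorm A.
Proof.
move=> bA bB AB; apply: opnorm_le => [|x]; first exact: opnorm_ge0.
have [->|Bx0] := eqVneq (nrm (B x)) 0; first by rewrite mulr_ge0 ?nrm_ge0 ?opnorm_ge0.
have Bx0' : 0 < nrm (B x) by rewrite lt_neqAle nrm_ge0 eq_sym Bx0.
rewrite -(ler_pM2r Bx0') -expr2.
have -> : nrm (B x) ^+ 2 = nrm (dot (A (B x)) x).
  by rewrite AB (dot_nrm hdot) nrm_real ger0_norm// sqr_ge0.
rewrite (le_trans (Cauchy_Schwarz hdot _ _))// mulrAC ler_wpM2r ?nrm_ge0//.
exact: le_opnorm.
Qed.

(** Being closed under adjoints is the one closure property that is awkward to
    verify for the sets [G] used below.  It suffices that [G] contain the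
    generator and its adjoint: the operators of [G] having an adjoint in [G] form
    a C*-subalgebra. *)
Lemma Cstar_ind G A A' : G `<=` bounded_op H -> G (fun=> 0) -> G idfun ->
  (forall a B C, G B -> G C -> G (fun x => a *: B x + C x)) ->
  (forall B C, G B -> G C -> G (B \o C)) ->
  (forall (B_ : nat -> H -> H) B, (forall n, G (B_ n)) -> bounded_op H B ->
     (fun n => opnorm (fun x => B_ n x - B x)) @ \oo --> (0 : R) -> G B) ->
  is_adjoint dot A A' -> G A -> G A' -> Cstar dot A `<=` G.
Proof.
move=> Gb G0 G1 Gcomb Gcomp Glim AA' GA GA' B.
move=> CB; suff [] : [set B | G B /\ exists2 C, G C & is_adjoint dot B C] B by [].
apply: CB; split; last first.
  move=> _ [->|->]; first by split=> //; exists A'.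
  by split=> //; exists idfun.
split.
- by move=> C [/Gb].
- by split=> //; exists (fun=> 0) => // x y; rewrite dot0l dot0r.
- move=> a C D [GC [C' GC' CC']] [GD [D' GD' DD']]; split; first exact: Gcomb.
  exists (fun x => Num.conj a *: C' x + D' x); first exact: Gcomb.
  exact: is_adjoint_comb.
- move=> C D [GC [C' GC' CC']] [GD [D' GD' DD']]; split; first exact: Gcomp.
  by exists (D' \o C'); [exact: Gcomp|exact: is_adjoint_comp].
- split.
    move=> C D [GC [C' GC' CC']] bD CD; rewrite (is_adjoint_unique he CD CC').
    by split=> //; exists C => //; exact: is_adjoint_sym.
  move=> C_ C CG bC lim; split; first by apply: Glim bC lim => n; exact: (CG n).1.
  have [D bD CD] := adjoint_exists hdot he bC.
  have /choice[D_ hD] : forall n, exists D', G D' /\ is_adjoint dot (C_ n) D'.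
    by move=> n; have [_ [D' GD' CD']] := CG n; exists D'.
  exists D => //; apply: (Glim D_) => // [n|]; first exact: (hD n).1.
  have bDD n : bounded_op H (fun x => D_ n x - D x).
    by apply: bounded_opB => //; exact: Gb (hD n).1.
  have bCC n : bounded_op H (fun x => C_ n x - C x).
    by apply: bounded_opB => //; exact: Gb (CG n).1.
  apply: squeeze_cvgr (cvg_cst 0) lim => //; apply: nearW => n.
  rewrite opnorm_ge0//=; apply: opnorm_adjoint_le => // x y.
  by rewrite dotBl (hD n).2 CD -dotBr.
Qed.

Section Subalgebra.
Context (S : set (H -> H)) (hS : Cstar_subalgebra dot S) (S1 : S idfun).

Lemma subalg_bounded A : S A -> bounded_op H A.
Proof. by case: hS => + _ _ _ _; apply. Qed.

Lemma subalg_comb a A B : S A -> S B -> S (fun x => a *: A x + B x).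
Proof. by case: hS => _ _ + _ _; apply. Qed.

Lemma subalg_comp A B : S A -> S B -> S (A \o B).
Proof. by case: hS => _ _ _ + _; apply. Qed.

Lemma subalg_scale a A : S A -> S (fun x => a *: A x).
Proof.
move=> SA; have := subalg_comb a SA (let: And5 _ S0 _ _ _ := hS in S0).
by under eq_fun do rewrite addr0.
Qed.

Lemma subalg_sum n (F : nat -> H -> H) : (forall k, S (F k)) ->
  S (fun x => \sum_(k < n) F k x).
Proof.
move=> SF; elim: n => [|n IHn].
  by under eq_fun do rewrite big_ord0; case: hS.
under eq_fun do rewrite big_ord_recr/=.
by have := subalg_comb 1 IHn (SF n); under eq_fun do rewrite scale1r.
Qed.

Lemma subalg_lim (A_ : nat -> H -> H) A (m : nat -> R) :
  (forall n, S (A_ n)) -> bounded_op H A -> (forall n, 0 <= m n) ->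
  (forall n x, nrm (A_ n x - A x) <= m n * nrm x) -> m @ \oo --> (0 : R) -> S A.
Proof.
move=> SA bA m0 Am lim; case: hS => _ _ _ _ [_]; apply; [exact: SA|exact: bA|].
apply: (opnorm_cvg0 (A_ := fun n x => A_ n x - A x)) m0 Am lim => n.
by apply: bounded_opB => //; exact: subalg_bounded.
Qed.

(** The powers of [A] converge in norm to the projection onto the eigenspace of
    1, because the rest of the spectrum lies in [[0, rho]]. *)
Lemma subalg_spectral_proj A P (a : nat -> R) (rho : R) :
  S A -> bounded_op H P -> 0 <= rho < 1 ->
  (forall n, A (e n) = (a n)%:C *: e n) ->
  (forall n, a n = 1 /\ P (e n) = e n \/ 0 <= a n <= rho /\ P (e n) = 0) -> S P.
Proof.
move=> SA bP /andP[rho0 rho1] Aa aP.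
have Sit m : S (iter m A) by elim: m => [|m IHm] //=; exact: subalg_comp.
have itE m n : iter m A (e n) = (a n ^+ m)%:C *: e n.
  elim: m => [|m IHm]; first by rewrite /= scale1r.
  rewrite iterS IHm (linZ _ _ (bounded_linear (subalg_bounded SA))) Aa scalerA.
  by rewrite -rmorphM /= exprSr.
apply: (subalg_lim (A_ := fun m => iter m A) (m := fun m => rho ^+ m)) => //.
- by move=> m; exact: exprn_ge0.
- move=> m x.
  (* [iter m A - P] is diagonal, with entry 0 where [P] is the identity. *)
  apply: (diagonal_bound hdot he (A := fun x => iter m A x - P x)
    (a := fun n => if `[<P (e n) = 0>] then (a n ^+ m)%:C else 0)).
  + by apply: bounded_opB => //; exact: subalg_bounded.
  + exact: exprn_ge0.
  + move=> n /=; rewrite itE; case: asboolP => [->|Pn0]; first by rewrite subr0.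
    have [[-> ->]|[_ //]] := aP n.
    by rewrite expr1n scale1r subrr scale0r.
  + move=> n; case: asboolP => [P0|_]; last by rewrite nrm0 exprn_ge0.
    have [[_ P1]|[/andP[an0 an1] _]] := aP n.
      by move: (nrm_e hdot he n); rewrite -P1 P0 nrm0 => /eqP; rewrite eq_sym oner_eq0.
    by rewrite nrm_real ger0_norm ?exprn_ge0// lerXn2r.
- by apply: cvg_expr; rewrite ger0_norm.
Qed.

End Subalgebra.
End CstarAlgebras.

(** * Weight sequences and isolated vertices *)

Section WeightSequences.
Context {R : realType}.
Implicit Types (x : nat -> R) (a k n : nat).

(** The diagonal entries of [T T^*]. *)
Definition inweight x n : R := if n is m.+1 then x m ^+ 2 else 0.

(** The diagonal entries of [T^*k T^k]. *)
Definition outweight x k n : R := \prod_(j < k) x (n + j)%N ^+ 2.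

(** When [inweight x a = 0], this compares the local data at [n] and at [a]; as a
    function of [n] it is the diagonal of a polynomial in [T] and [T^*]. *)
Definition discrepancy x a k n : R :=
  inweight x n + \sum_(i < k) (outweight x i n - outweight x i a) ^+ 2.

(** Only large [n] are constrained, so that a component may be repeated finitely
    often.  The bound [m.+1%:R^-1] instead of an arbitrary positive real keeps the
    quantifiers countable, which matters for measurability. *)
Definition isolated x a : Prop := inweight x a = 0 /\
  exists k m N, forall n, (N <= n)%N -> m.+1%:R^-1 <= discrepancy x a k n.

Lemma outweight0 x n : outweight x 0 n = 1.
Proof. by rewrite /outweight big_ord0. Qed.

Lemma outweightS x k n : outweight x k.+1 n = x n ^+ 2 * outweight x k n.+1.
Proof.
rewrite /outweight big_ord_recl addn0; congr (_ * _).
by apply: eq_bigr => j _; rewrite lift0 addSnnS.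
Qed.

Lemma outweightSr x k n : outweight x k.+1 n = outweight x k n * x (n + k)%N ^+ 2.
Proof. by rewrite /outweight big_ord_recr. Qed.

Lemma inweight_ge0 x n : 0 <= inweight x n.
Proof. by case: n => //= n; exact: sqr_ge0. Qed.

Lemma outweight_ge0 x k n : 0 <= outweight x k n.
Proof. by apply: prodr_ge0 => j _; exact: sqr_ge0. Qed.

Lemma discrepancy_ge0 x a k n : 0 <= discrepancy x a k n.
Proof.
by rewrite addr_ge0 ?inweight_ge0// sumr_ge0// => i _; exact: sqr_ge0.
Qed.

Lemma discrepancy_le_in x a k n : inweight x n <= discrepancy x a k n.
Proof. by rewrite lerDl sumr_ge0// => i _; exact: sqr_ge0. Qed.

Lemma discrepancy_le_out x a k n i : (i < k)%N ->
  (outweight x i n - outweight x i a) ^+ 2 <= discrepancy x a k n.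
Proof.
move=> ik; rewrite /discrepancy (bigD1 (Ordinal ik))//= addrCA lerDl.
by rewrite addr_ge0 ?inweight_ge0// sumr_ge0// => j _; exact: sqr_ge0.
Qed.

Lemma discrepancy_bounded x a k (M : R) : (forall n, 0 <= x n <= M) ->
  exists2 C, 0 <= C & forall n, discrepancy x a k n <= C.
Proof.
move=> xM; have M0 : 0 <= M by have /andP[/le_trans h /h] := xM 0%N.
have x2 n : x n ^+ 2 <= M ^+ 2.
  by have /andP[x0 x1] := xM n; rewrite ler_sqr ?nnegrE.
have oM i n : outweight x i n <= (M ^+ 2) ^+ i.
  rewrite -{2}(card_ord i) -prodr_const; apply: ler_prod => j _.
  by rewrite sqr_ge0 x2.
exists (M ^+ 2 + \sum_(i < k) ((M ^+ 2) ^+ i) ^+ 2).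
  by rewrite addr_ge0 ?sqr_ge0// sumr_ge0// => i _; exact: sqr_ge0.
move=> n; rewrite lerD//; first by case: n => [|n] /=; rewrite ?sqr_ge0.
apply: ler_sum => i _; rewrite -[X in X <= _]real_normK ?num_real// ler_sqr ?nnegrE ?exprn_ge0 ?sqr_ge0//.
rewrite ler_norml; have := oM i n; have := oM i a.
by have := outweight_ge0 x i n; have := outweight_ge0 x i a; lra.
Qed.

(** The finitely many exceptional terms only lower the gap. *)
Lemma positive_gap (f : nat -> R) (dl : R) N : (forall n, 0 <= f n) -> 0 < dl ->
  (forall n, (N <= n)%N -> f n = 0 \/ dl <= f n) ->
  exists2 dl', 0 < dl' & forall n, f n = 0 \/ dl' <= f n.
Proof.
move=> f0; elim: N dl => [|N IHN] dl dl0 fdl.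
  by exists dl => // n; exact: fdl.
have [fN0|fN0] := eqVneq (f N) 0.
  by apply: (IHN dl dl0) => n; rewrite leq_eqVlt => /orP[/eqP<-|/fdl//]; left.
apply: (IHN (Num.min dl (f N))); first by rewrite lt_min dl0 lt_neqAle eq_sym fN0 f0.
move=> n; rewrite leq_eqVlt => /orP[/eqP<-|/fdl[->|h]]; [right|by left|right].
  by rewrite ge_min lexx orbT.
by rewrite ge_min h.
Qed.

End WeightSequences.

(** * Diagonal operators in the algebra of a weighted shift *)

Section WeightedShift.
Context (R : realType) (H : completeNormedModType R[i]).
Context (dot : {dot H for (@Num.conj R[i])}) (hdot : hilbert_inner_product dot).
Context (e : nat -> H) (he : orthonormal_basis dot e).
Context (x : nat -> R) (x_ge0 : forall n, 0 <= x n).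
Context (T : H -> H) (bT : bounded_op H T) (Te : forall n, T (e n) = (x n)%:C *: e n.+1).
Context (T' : H -> H) (bT' : bounded_op H T') (TT' : is_adjoint dot T T').

Let S := Cstar dot T.
Let hS : Cstar_subalgebra dot S. Proof. exact: Cstar_is_subalgebra. Qed.
Let S1 : S idfun. Proof. exact: Cstar_id. Qed.
Let ST : S T. Proof. exact: Cstar_self. Qed.
Let ST' : S T'.
Proof. by case: hS => _ _ _ _ [cl _]; exact: cl ST bT' TT'. Qed.
Let lT := bounded_linear bT.
Let lT' := bounded_linear bT'.

Lemma adjoint_shift n : T' (e n.+1) = (x n)%:C *: e n.
Proof.
apply: (eq_coord he) => k; rewrite dotC -TT' Te !dotZl !(dot_e he) eqSS.
rewrite rmorphM /= rmorph_nat eq_sym.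
by case: eqVneq => [->|]; rewrite ?mulr0// !mulr1 conj_Creal// complex_real eqxx.
Qed.

Lemma adjoint_shift0 : T' (e 0) = 0.
Proof.
by apply: (eq_coord he) => k; rewrite dotC -TT' Te dotZl (dot_e he) dot0l mulr0 rmorph0.
Qed.

Lemma weights_bounded : exists M : R, forall n, 0 <= x n <= M.
Proof.
have /bounded_opP[_ [M M0 TM]] := bT.
exists M => n; rewrite x_ge0/=; have := TM (e n).
by rewrite Te nrmZ !(nrm_e hdot he) !mulr1 nrm_real ger0_norm.
Qed.

Definition diagonal (a : nat -> R) := exists2 A, S A & forall n, A (e n) = (a n)%:C *: e n.

Lemma diagonal_const c : diagonal (fun=> c).
Proof.
exists (fun y => c%:C *: idfun y) => //; exact: (subalg_scale hS c%:C S1).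
Qed.

Lemma diagonal_comb c a b : diagonal a -> diagonal b ->
  diagonal (fun n => c * a n + b n).
Proof.
move=> [A SA Aa] [B SB Bb]; exists (fun y => c%:C *: A y + B y).
  exact: (subalg_comb hS c%:C SA SB).
by move=> n; rewrite Aa Bb scalerA -scalerDl rmorphD rmorphM.
Qed.

Lemma diagonalM a b : diagonal a -> diagonal b -> diagonal (fun n => a n * b n).
Proof.
move=> [A SA Aa] [B SB Bb]; exists (A \o B); first exact: (subalg_comp hS).
move=> n; rewrite /= Bb (linZ _ _ (bounded_linear (subalg_bounded hS SA))) Aa.
by rewrite scalerA -rmorphM mulrC.
Qed.

Lemma diagonalB a b : diagonal a -> diagonal b -> diagonal (fun n => a n - b n).
Proof.
by move=> da /(diagonal_comb (-1)) /(_ da); under eq_fun do rewrite mulN1r addrC.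
Qed.

Lemma diagonal_sum k (a : nat -> nat -> R) : (forall i, diagonal (a i)) ->
  diagonal (fun n => \sum_(i < k) a i n).
Proof.
move=> da; elim: k => [|k IHk].
  by under eq_fun do rewrite big_ord0; exact: diagonal_const.
under eq_fun do rewrite big_ord_recr/=.
by have := diagonal_comb 1 IHk (da k); under eq_fun do rewrite mul1r.
Qed.

Lemma diagonal_inweight : diagonal (inweight x).
Proof.
exists (T \o T'); first exact: (subalg_comp hS).
case=> [|n] /=; first by rewrite adjoint_shift0 (lin0 lT) scale0r.
by rewrite adjoint_shift (linZ _ _ lT) Te scalerA -rmorphM expr2.
Qed.

(** If [A] is diagonal with entries [a n], then [T^* A T] is diagonal with entries
    [x n ^ 2 * a n.+1]. *)
Lemma diagonal_outweight k : diagonal (outweight x k).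
Proof.
elim: k => [|k [A SA Ak]].
  rewrite (_ : outweight x 0 = fun=> 1); first exact: diagonal_const.
  by apply/funext => n; rewrite outweight0.
exists (T' \o (A \o T)); first by do 2![apply: (subalg_comp hS) => //].
move=> n /=; rewrite Te (linZ _ _ (bounded_linear (subalg_bounded hS SA))) Ak.
rewrite !(linZ _ _ lT') adjoint_shift !scalerA outweightS -!rmorphM.
by congr (_%:C *: _); ring.
Qed.

Lemma diagonal_discrepancy a k : diagonal (discrepancy x a k).
Proof.
have := diagonal_comb 1 diagonal_inweight (diagonal_sum k
  (fun i => diagonalM (diagonalB (diagonal_outweight i) (diagonal_const (outweight x i a)))
    (diagonalB (diagonal_outweight i) (diagonal_const (outweight x i a))))).
by congr diagonal; apply/funext => n; rewrite mul1r /discrepancy; congr (_ + _).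
Qed.

(** With [g] the discrepancy from [a] and [C] a bound of [g], the diagonal element
    [1 - g / (C + 1)] is 1 where [g] vanishes and at most [1 - dl / (C + 1)]
    elsewhere, [dl] being the gap of [g] above 0.  The zero set of [g] contains
    [a], is finite because [a] is isolated, and consists of vertices with zero
    inweight. *)
Lemma isolated_projection a : isolated x a ->
  exists P, [/\ S P, compact_op H P, P (e a) = e a &
    forall n, inweight x n != 0 -> P (e n) = 0].
Proof.
move=> [xa0 [k [m [N gN]]]]; set g := discrepancy x a k in gN.
have g0 n : 0 <= g n by exact: discrepancy_ge0.
have m0 : 0 < (m.+1%:R^-1 : R) by rewrite invr_gt0.
have ga : g a = 0.
  by rewrite /g /discrepancy xa0 add0r big1// => i _; rewrite subrr expr0n.
have [dl dl0 gdl] : exists2 dl, 0 < dl & forall n, g n = 0 \/ dl <= g n.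
  by apply: (positive_gap g0 m0) => n /gN h; right; exact: h.
have gN0 n : g n = 0 -> (n < N)%N.
  move=> gn0; rewrite ltnNge; apply/negP => /gN.
  by rewrite -/g gn0 leNgt m0.
have [M xM] := weights_bounded.
have [C C0 gC] := discrepancy_bounded a k xM.
have {gC} gC n : g n <= C by exact: gC.
have C1 : 0 < C + 1 by rewrite ltr_wpDl.
pose P y := \sum_(i < N) (if g i == 0 then dot y (e i) else 0) *: e i.
have cP : compact_op H P.
  apply: (compact_op_sum hdot N (F := fun i y => (if g i == 0 then dot y (e i) else 0) *: e i)).
  move=> i; case: eqP => _; first exact: (compact_rank_one hdot).
  by under eq_fun do rewrite scale0r; exact: (compact_op0 hdot).
have Pe n : P (e n) = if g n == 0 then e n else 0.
  apply: (eq_coord he) => j; rewrite /P.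
  rewrite (dot_sum_e he (fun i => if g i == 0 then dot (e n) (e i) else 0)).
  case: ifPn => [jN|]; last first.
    rewrite -leqNgt => Nj; case: ifPn => [/eqP /gN0 nN|_]; last by rewrite dot0l.
    by rewrite (dot_e he) ltn_eqF// (leq_trans nN).
  have [->|nj] := eqVneq n j; first by case: ifP; rewrite ?dot0l.
  by do 2![case: ifP => _]; rewrite ?dot0l// (dot_e he) (negbTE nj).
exists P; split=> //; last 2 first.
- by rewrite Pe ga eqxx.
- move=> n xn0; rewrite Pe gt_eqF// lt_neqAle g0 andbT eq_sym.
  apply: contra xn0 => /eqP gn0; apply/eqP/le_anti.
  by rewrite inweight_ge0 andbT -gn0 discrepancy_le_in.
have [A SA Aa] := diagonal_comb (- (C + 1)^-1) (diagonal_discrepancy a k) (diagonal_const 1).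
apply: (subalg_spectral_proj hdot he hS S1 (A := A) (rho := 1 - dl / (C + 1)) _ _ _ Aa) => //.
- exact: cP.1.
- have := gdl N => -[/gN0|dlN]; first by rewrite ltnn.
  rewrite subr_ge0 ler_pdivrMr// mul1r (le_trans dlN) ?(le_trans (gC N)) ?lerDl//=.
  by rewrite ltrBlDr ltrDl divr_gt0.
move=> n; rewrite -/g Pe; have [gn0|gn] := gdl n; [left|right].
  by rewrite gn0 eqxx mulr0 add0r.
rewrite gt_eqF; last exact: lt_le_trans gn.
rewrite mulNr addrC subr_ge0 mulrC ler_pdivrMr// mul1r (le_trans (gC n)) ?lerDl//=.
by split=> //; rewrite lerB// ler_pM2r ?invr_gt0.
Qed.

End WeightedShift.

(** * Algebras containing all compact operators *)

Section CompactsInShiftAlgebra.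
Context (R : realType) (H : completeNormedModType R[i]).
Context (dot : {dot H for (@Num.conj R[i])}) (hdot : hilbert_inner_product dot).
Context (e : nat -> H) (he : orthonormal_basis dot e).
Context (x : nat -> R) (x_ge0 : forall n, 0 <= x n).
Context (T : H -> H) (bT : bounded_op H T) (Te : forall n, T (e n) = (x n)%:C *: e n.+1).

Let S := Cstar dot T.
Let hS : Cstar_subalgebra dot S. Proof. exact: Cstar_is_subalgebra. Qed.
Let ST : S T. Proof. exact: Cstar_self. Qed.
Let lT := bounded_linear bT.

(** Starting from the projection onto [e 0], left multiplication by [T] raises
    the row index and right multiplication by [T^*] raises the column index, up to
    nonzero factors. *)
Lemma matrix_units_mem : (forall n, 0 < x n) -> isolated x 0 ->
  forall i j, S (fun y => dot y (e j) *: e i).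
Proof.
move=> xgt0 iso.
have [T' bT' TT'] := adjoint_exists hdot he bT.
have ST' : S T' by case: hS => _ _ _ _ [cl _]; exact: cl ST bT' TT'.
have lT' := bounded_linear bT'.
have xC n : (x n)%:C != 0 by rewrite fmorph_eq0 gt_eqF.
have [P [SP _ P0 PN]] := isolated_projection hdot he x_ge0 bT Te bT' TT' iso.
have unit i j : exists2 A, S A & forall n, A (e n) = (n == j)%:R *: e i.
  elim: j => [|j [A SA Ae]]; last first.
    exists (fun y => (x j)%:C^-1 *: (A \o T') y).
      by apply: (subalg_scale hS); exact: (subalg_comp hS).
    have lA := bounded_linear (subalg_bounded hS SA).
    case=> [|n] /=; first by rewrite (adjoint_shift0 he Te TT') (lin0 lA) scaler0 scale0r.
    rewrite (adjoint_shift he Te TT') (linZ _ _ lA) Ae eqSS.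
    by have [->|_] := eqVneq n j; rewrite ?scale0r ?scaler0// scalerA mulVf// scale1r.
  elim: i => [|i [A SA Ae]].
    exists P => // -[|n]; first by rewrite P0 scale1r.
    by rewrite PN ?scale0r//= sqrf_eq0 gt_eqF.
  exists (fun y => (x i)%:C^-1 *: (T \o A) y).
    by apply: (subalg_scale hS); exact: (subalg_comp hS).
  move=> n /=; rewrite Ae (linZ _ _ lT) Te.
  by case: eqVneq => _; rewrite ?scale0r ?scaler0// !scale1r scalerA mulVf// scale1r.
move=> i j; have [A SA Ae] := unit i j.
suff <- : A = (fun y => dot y (e j) *: e i) by [].
apply: (op_ext he) => [||n]; first exact: (subalg_bounded hS).
  exact: (compact_rank_one hdot _ _).1.
by rewrite Ae (dot_e he).
Qed.

Lemma rank_one_mem i v : (forall i j, S (fun y => dot y (e j) *: e i)) ->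
  S (fun y => dot y v *: e i).
Proof.
move=> unit.
apply: (subalg_lim hS (A_ := fun M y => \sum_(j < M) Num.conj (dot v (e j)) *: (dot y (e j) *: e i))
  (m := fun M => nrm (v - projn dot e M v))).
- move=> M; apply: (subalg_sum hS M (F := fun j y => Num.conj (dot v (e j)) *: (dot y (e j) *: e i))).
  by move=> j; exact: (subalg_scale hS).
- exact: (compact_rank_one hdot _ _).1.
- by move=> M; exact: nrm_ge0.
- move=> M y.
  have -> : \sum_(j < M) Num.conj (dot v (e j)) *: (dot y (e j) *: e i) =
      dot y (projn dot e M v) *: e i.
    rewrite /projn dot_sumr scaler_suml; apply: eq_bigr => j _.
    by rewrite dotZr scalerA.
  rewrite -scalerBl -dotBr nrmZ (nrm_e hdot he) mulr1 nrmB mulrC.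
  by rewrite (le_trans (Cauchy_Schwarz hdot _ _))// -[X in _ * X <= _]nrmN opprB nrmB.
apply/cvgrPdist_lt => eps eps0; have := cvg_nrm_near (cvg_proj he (x := v)) eps0.
by apply: filterS => M; rewrite sub0r normrN ger0_norm ?nrm_ge0.
Qed.

(** A compact [K] is the norm limit of its finitely many first rows, by
    [compact_tail]; each row is an operator of rank one with range spanned by some
    [e i], and is a limit of combinations of matrix units. *)
Lemma compact_sub_Cstar : (forall n, 0 < x n) -> isolated x 0 ->
  compact_op H `<=` S.
Proof.
move=> xgt0 iso K cK; have bK := cK.1.
have unit := matrix_units_mem xgt0 iso.
have [K' bK' KK'] := adjoint_exists hdot he bK.
have SpK n : S (fun y => projn dot e n (K y)).
  apply: (subalg_sum hS n (F := fun i y => dot (K y) (e i) *: e i)) => i.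
  by under eq_fun do rewrite KK'; exact: rank_one_mem.
have bD n : bounded_op H (fun y => projn dot e n (K y) - K y).
  by apply: bounded_opB => //; exact: (subalg_bounded hS).
apply: (subalg_lim hS (A_ := fun n y => projn dot e n (K y))
   (m := fun n => opnorm (fun y => projn dot e n (K y) - K y))) => //.
- by move=> n; exact: opnorm_ge0.
- by move=> n y; exact: (le_opnorm y (bD n)).
apply/cvgrPdist_le => eps eps0; have := compact_tail hdot he cK eps0.
apply: filterS => n tl; rewrite sub0r normrN ger0_norm ?opnorm_ge0//.
by apply: opnorm_le => [|y]; [exact: ltW|rewrite nrmB].
Qed.

(** As [x m = 0], neither [T] nor [T^*] leaves the orthogonal complement of
    [e 0, ..., e m], and this invariance passes to the generated algebra. *)
Lemma zero_weight_reducing m A : x m = 0 -> S A -> forall v,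
  (forall i, (i <= m)%N -> dot v (e i) = 0) ->
  forall i, (i <= m)%N -> dot (A v) (e i) = 0.
Proof.
move=> xm0.
pose G := [set A : H -> H | bounded_op H A /\ forall v,
  (forall i, (i <= m)%N -> dot v (e i) = 0) ->
  forall i, (i <= m)%N -> dot (A v) (e i) = 0].
have [T' bT' TT'] := adjoint_exists hdot he bT.
suff SG : S `<=` G by move=> /SG[].
apply: (Cstar_ind hdot he (G := G) (A' := T')) => //.
- by move=> B [].
- by split=> [|v _ i _]; [exact: bounded_op0|rewrite dot0l].
- by split=> //; exact: bounded_op_id.
- move=> a B C [bB GB] [bC GC]; split; first exact: bounded_op_comb.
  by move=> v v0 i im; rewrite dotDl dotZl GB// GC// mulr0 addr0.
- move=> B C [bB GB] [bC GC]; split; first exact: bounded_op_comp.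
  by move=> v v0 i im; apply: GB => // j jm; exact: GC.
- move=> B_ B GB bB lim; split=> // v v0 i im.
  apply/eqP; rewrite -nrm_eq0; apply/eqP/le_anti; rewrite nrm_ge0 andbT.
  have lim2 : (fun n => opnorm (fun x => B_ n x - B x) * nrm v) @ \oo --> (0 : R).
    by rewrite -(mul0r (nrm v)); apply: cvgM => //; exact: cvg_cst.
  apply: (ler_cvg_to (cvg_cst _) lim2); apply: nearW => n.
  have -> : nrm (dot (B v) (e i)) = nrm (dot (B_ n v - B v) (e i)).
    by rewrite dotBl (GB n).2// sub0r nrmN.
  rewrite (le_trans (Cauchy_Schwarz hdot _ _))// (nrm_e hdot he) mulr1.
  by apply: (le_opnorm v); apply: bounded_opB => //; exact: (GB n).1.
- split=> // v v0 [|i] im; rewrite TT'.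
    by rewrite (adjoint_shift0 he Te TT') dot0r.
  by rewrite (adjoint_shift he Te TT') dotZr v0 ?mulr0// ltnW.
- split=> // v v0 i im; rewrite (is_adjoint_sym TT') Te dotZr.
  move: im; rewrite leq_eqVlt => /orP[/eqP->|im]; last by rewrite v0// mulr0.
  by rewrite xm0 rmorph0 mul0r.
Qed.

Lemma compact_sub_Cstar_weight_gt0 : compact_op H `<=` S -> forall n, 0 < x n.
Proof.
move=> KS m; rewrite lt_neqAle x_ge0 andbT eq_sym; apply/eqP => xm0.
have /KS Sr := compact_rank_one hdot (e m.+1) (e 0).
have := zero_weight_reducing xm0 Sr (v := e m.+1) _ (i := 0) (leq0n _).
rewrite dotZl !(dot_e he) !eqxx mulr1 => h.
have : (1 : R[i]) = 0 by apply: h => i im; rewrite (dot_e he) gtn_eqF.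
by move/eqP; rewrite oner_eq0.
Qed.

End CompactsInShiftAlgebra.

(** * Vertices whose local data recur *)

Section RecurrentVertex.
Context (R : realType) (H : completeNormedModType R[i]).
Context (dot : {dot H for (@Num.conj R[i])}) (hdot : hilbert_inner_product dot).
Context (e : nat -> H) (he : orthonormal_basis dot e).
Context (x : nat -> R) (x_ge0 : forall n, 0 <= x n).
Context (T : H -> H) (bT : bounded_op H T) (Te : forall n, T (e n) = (x n)%:C *: e n.+1).

Let lT := bounded_linear bT.

(** The images [T^s (e n)] are used rather than the basis vectors [e (n + s)]:
    they vanish by themselves at the end of the component of [n], so that the
    components of [T] need no separate treatment. *)
Definition vpath s n : H := iter s T (e n).

Lemma vpathE s n : vpath s n = (\prod_(j < s) x (n + j)%N)%:C *: e (n + s)%N.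
Proof.
elim: s => [|s IHs]; first by rewrite big_ord0 scale1r addn0.
rewrite /vpath iterS -/(vpath s n) IHs (linZ _ _ lT) Te scalerA -rmorphM.
by rewrite big_ord_recr addnS.
Qed.

Lemma nrm_sum_vpath N (c : nat -> R[i]) n :
  nrm (\sum_(k < N) c k *: vpath k n) ^+ 2 =
  \sum_(k < N) nrm (c k) ^+ 2 * outweight x k n.
Proof.
under eq_bigr do rewrite vpathE scalerA.
rewrite (nrm_sum_orth hdot he (fun k => c k * (\prod_(j < k) x (n + j)%N)%:C)); last first.
  by move=> i j /addnI.
by apply: eq_bigr => k _; rewrite nrmM exprMn nrm_real real_normK ?num_real// /outweight prodrXl.
Qed.

Lemma nrm_vpath s n : nrm (vpath s n) ^+ 2 = outweight x s n.
Proof.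
rewrite vpathE nrmZ (nrm_e hdot he) mulr1 nrm_real real_normK ?num_real//.
by rewrite /outweight prodrXl.
Qed.

Lemma nrm_vpath_bounded s : exists2 M : R, 0 <= M & forall n, nrm (vpath s n) <= M.
Proof.
have /bounded_opP[_ [M M0 TM]] := bT.
exists (M ^+ s) => [|n]; first exact: exprn_ge0.
elim: s => [|s IHs]; first by rewrite /vpath /= (nrm_e hdot he) expr0.
by rewrite /vpath iterS exprS (le_trans (TM _))// ler_wpM2l.
Qed.

Context (a : nat) (q : nat -> nat).
Context (ina0 : inweight x a = 0).
Context (q_in : (fun j => inweight x (q j)) @ \oo --> (0 : R)).
Context (q_out : forall i, (fun j => outweight x i (q j)) @ \oo --> outweight x i a).

(** A filter of vertices: what holds both at [a] and at [q j] for [j] large. *)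
Definition typical (Q : nat -> Prop) := Q a /\ \forall j \near \oo, Q (q j).

Lemma typical_and Q1 Q2 : typical Q1 -> typical Q2 -> typical (fun n => Q1 n /\ Q2 n).
Proof.
by move=> [Q1a Q1j] [Q2a Q2j]; split=> //; move: Q1j Q2j; exact: filterS2.
Qed.

Lemma typicalS (Q1 Q2 : nat -> Prop) : (forall n, Q1 n -> Q2 n) -> typical Q1 -> typical Q2.
Proof. by move=> Q12 [Q1a Q1j]; split; [exact: Q12|apply: filterS Q1j => j; exact: Q12]. Qed.

Lemma typicalT (Q : nat -> Prop) : (forall n, Q n) -> typical Q.
Proof. by move=> Qn; split=> //; exact: nearW. Qed.

(** One combination of the paths issued from [n] serves for all typical [n] at
    once.  Allowing every [N >= N0] lets two approximations be added without
    adjusting their lengths. *)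
Definition uniformly_approximable (w : nat -> H) := forall eps : R, 0 < eps ->
  exists (c : nat -> R[i]) N0, forall N, (N0 <= N)%N ->
    typical (fun n => nrm (w n - \sum_(k < N) c k *: vpath k n) <= eps).

Let P := uniformly_approximable.

Lemma approx_lim w : (forall eps : R, 0 < eps -> exists2 w', P w' &
  typical (fun n => nrm (w n - w' n) <= eps)) -> P w.
Proof.
move=> hw eps eps0; have e2 : 0 < eps / 2 by rewrite divr_gt0.
have [w' Pw' ww'] := hw _ e2.
have [c [N0 cN]] := Pw' _ e2; exists c, N0 => N /cN cN'.
apply: typicalS (typical_and ww' cN') => n [h1 h2].
by rewrite (splitr eps) (le_trans (ler_nrm_dist _ (w' n) _))// lerD.
Qed.

Lemma approx_vpath s : P (vpath s).
Proof.
move=> eps eps0; exists (fun k => (k == s)%:R), s.+1 => N sN; apply: typicalT => n.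
rewrite (bigD1 (Ordinal sN))//= eqxx scale1r big1 ?addr0 ?subrr ?nrm0 ?ltW//.
by move=> k; rewrite -val_eqE/= => /negbTE ->; rewrite scale0r.
Qed.

Lemma approx0 : P (fun=> 0).
Proof.
move=> eps eps0; exists (fun=> 0), 0%N => N _; apply: typicalT => n.
by rewrite big1 ?subrr ?nrm0 ?ltW// => k _; rewrite scale0r.
Qed.

Lemma approx_comb b w w' : P w -> P w' -> P (fun n => b *: w n + w' n).
Proof.
move=> Pw Pw' eps eps0; have e2 : 0 < eps / 2 by rewrite divr_gt0.
have b1 : 0 < nrm b + 1 by rewrite ltr_wpDl ?nrm_ge0.
have eb : 0 < eps / 2 / (nrm b + 1) by rewrite divr_gt0.
have [c [N0 cN]] := Pw _ eb; have [c' [N0' cN']] := Pw' _ e2.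
exists (fun k => b * c k + c' k), (maxn N0 N0') => N.
rewrite geq_max => /andP[/cN h /cN' h']; apply: typicalS (typical_and h h') => n [hn hn'].
have -> : b *: w n + w' n - \sum_(k < N) (b * c k + c' k) *: vpath k n =
    b *: (w n - \sum_(k < N) c k *: vpath k n) + (w' n - \sum_(k < N) c' k *: vpath k n).
  rewrite scalerBr addrACA; congr (_ + _); rewrite -opprD; congr (- _).
  rewrite scaler_sumr -big_split; apply: eq_bigr => k _ /=.
  by rewrite scalerDl scalerA.
rewrite (splitr eps) (le_trans (ler_nrmD _ _))// lerD// nrmZ.
rewrite (le_trans (ler_wpM2l (nrm_ge0 _) hn))// mulrCA ler_piMr ?(ltW e2)//.
by rewrite ler_pdivrMr// mul1r lerDl.
Qed.

Lemma approx_scale b w : P w -> P (fun n => b *: w n).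
Proof. by move=> Pw; have := approx_comb b Pw approx0; under eq_fun do rewrite addr0. Qed.

Lemma approx_sum N (w : nat -> nat -> H) : (forall k, P (w k)) ->
  P (fun n => \sum_(k < N) w k n).
Proof.
move=> Pw; elim: N => [|N IHN]; first by under eq_fun do rewrite big_ord0; exact: approx0.
under eq_fun do rewrite big_ord_recr/=.
by have := approx_comb 1 IHN (Pw N); under eq_fun do rewrite scale1r.
Qed.

(** Apply [A] to an approximating combination of [w]. *)
Lemma approx_op A w : bounded_op H A -> (forall s, P (fun n => A (vpath s n))) ->
  P w -> P (fun n => A (w n)).
Proof.
move=> /bounded_opP[lA [M M0 AM]] PA Pw; apply: approx_lim => eps eps0.
have M1 : 0 < M + 1 by rewrite ltr_wpDl.
have [|c [N cN]] := Pw (eps / (M + 1)); first by rewrite divr_gt0.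
exists (fun n => A (\sum_(k < N) c k *: vpath k n)).
  under eq_fun do rewrite (lin_sum _ lA).
  apply: (approx_sum _ (w := fun k n => A (c k *: vpath k n))) => k.
  by under eq_fun do rewrite (linZ _ _ lA); exact: approx_scale.
apply: typicalS (cN N (leqnn _)) => n h.
rewrite -(linB _ _ lA) (le_trans (AM _))// (le_trans (ler_wpM2l M0 h))//.
by rewrite mulrCA ler_piMr ?(ltW eps0)// ler_pdivrMr// mul1r lerDl.
Qed.

(** For [s = 0], the squared norm of [T^* (e n)] is the inweight of [n], which is
    0 at [a] and tends to 0 along [q].  For [s.+1], [T^* (T^s.+1 (e n))] is
    [x (n + s) ^ 2] times [T^s (e n)]; replacing this coefficient by its value at
    [a] is harmless by the convergence of the outweights, even though the
    weights themselves converge only as long as the outweight at [a] is not 0. *)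
Lemma approx_adjoint T' s : bounded_op H T' -> is_adjoint dot T T' ->
  P (fun n => T' (vpath s n)).
Proof.
move=> bT' TT'; have lT' := bounded_linear bT'.
case: s => [|s]; apply: approx_lim => eps eps0.
  exists (fun=> 0); first exact: approx0.
  have T'e n : nrm (T' (vpath 0 n) - 0) ^+ 2 = inweight x n.
    rewrite subr0 /vpath /=; case: n => [|n].
      by rewrite (adjoint_shift0 he Te TT') nrm0 expr0n.
    rewrite (adjoint_shift he Te TT') nrmZ (nrm_e hdot he) mulr1 nrm_real.
    by rewrite real_normK ?num_real.
  split; first by rewrite -ler_sqr ?nnegrE ?nrm_ge0 ?(ltW eps0)// T'e ina0 sqr_ge0.
  have /cvgrPdist_le/(_ _ (exprn_gt0 2 eps0)) := q_in; apply: filterS => j.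
  rewrite sub0r normrN ger0_norm ?inweight_ge0// -T'e.
  by rewrite ler_sqr ?nnegrE ?nrm_ge0 ?(ltW eps0).
have T'v n : T' (vpath s.+1 n) = (x (n + s)%N ^+ 2)%:C *: vpath s n.
  rewrite !vpathE (linZ _ _ lT') addnS (adjoint_shift he Te TT') !scalerA.
  by rewrite -!rmorphM big_ord_recr; congr (_%:C *: _) => /=; ring.
exists (fun n => (x (a + s)%N ^+ 2)%:C *: vpath s n).
  exact/approx_scale/approx_vpath.
(* The second factor tends to 0 along [q]; the first one is only bounded. *)
have dE n : nrm (T' (vpath s.+1 n) - (x (a + s)%N ^+ 2)%:C *: vpath s n) ^+ 2 =
    (x (n + s)%N ^+ 2 - x (a + s)%N ^+ 2) *
    (outweight x s.+1 n - x (a + s)%N ^+ 2 * outweight x s n).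
  rewrite T'v -scalerBl nrmZ exprMn nrm_vpath -rmorphB nrm_real.
  by rewrite real_normK ?num_real// outweightSr; ring.
split.
  rewrite -ler_sqr ?nnegrE ?nrm_ge0 ?(ltW eps0)// dE.
  by rewrite subrr mul0r sqr_ge0.
have [M xM] := weights_bounded hdot he x_ge0 bT Te.
have x2 n : 0 <= x n ^+ 2 <= M ^+ 2.
  have /andP[h0 h1] := xM n; rewrite sqr_ge0/= ler_sqr ?nnegrE//.
  exact: le_trans h0 h1.
pose D j := outweight x s.+1 (q j) - x (a + s)%N ^+ 2 * outweight x s (q j).
have D0 : D @ \oo --> (0 : R).
  have -> : (0 : R) = outweight x s.+1 a - x (a + s)%N ^+ 2 * outweight x s a.
    by rewrite outweightSr mulrC subrr.
  by apply: cvgB; [exact: q_out|apply: cvgM; [exact: cvg_cst|exact: q_out]].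
have B0 : (fun j => M ^+ 2 * `|D j|) @ \oo --> (0 : R).
  rewrite -(mulr0 (M ^+ 2)); apply: cvgM; first exact: cvg_cst.
  by rewrite -(normr0 R); exact: cvg_norm D0.
have /cvgrPdist_le/(_ _ (exprn_gt0 2 eps0)) := B0; apply: filterS => j h.
rewrite -ler_sqr ?nnegrE ?nrm_ge0 ?(ltW eps0)// dE -/(D j).
rewrite sub0r normrN ger0_norm in h; last exact: mulr_ge0 (sqr_ge0 _) (normr_ge0 _).
apply: le_trans h.
rewrite (le_trans (ler_norm _))// normrM ler_wpM2r//.
have := x2 (q j + s)%N; have := x2 (a + s)%N => /andP[? ?] /andP[? ?].
by rewrite ler_norml; apply/andP; split; lra.
Qed.

(** The operators [A] of the conclusion are closed under all operations of
    [Cstar_ind]. *)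
Lemma Cstar_approx A : Cstar dot T A -> forall s, P (fun n => A (vpath s n)).
Proof.
pose G := [set A : H -> H | bounded_op H A /\ forall s, P (fun n => A (vpath s n))].
have [T' bT' TT'] := adjoint_exists hdot he bT.
suff SG : Cstar dot T `<=` G by move=> /SG[].
apply: (Cstar_ind hdot he (G := G) (A' := T')) => //.
- by move=> B [].
- by split=> [|s]; [exact: bounded_op0|exact: approx0].
- by split=> [|s]; [exact: bounded_op_id|exact: approx_vpath].
- move=> b B C [bB PB] [bC PC]; split=> [|s]; first exact: bounded_op_comb.
  exact: approx_comb.
- move=> B C [bB PB] [bC PC]; split=> [|s]; first exact: bounded_op_comp.
  by apply: (approx_op bB PB (w := fun n => C (vpath s n))).
- move=> B_ B GB bB lim; split=> // s; apply: approx_lim => eps eps0.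
  have [M M0 vM] := nrm_vpath_bounded s.
  have M1 : 0 < M + 1 by rewrite ltr_wpDl.
  have eM : 0 < eps / (M + 1) by rewrite divr_gt0.
  have /cvgrPdist_lt/(_ _ eM)[j _ /(_ j (leqnn _))/=] := lim.
  have bd : bounded_op H (fun y => B_ j y - B y) by apply: bounded_opB => //; exact: (GB j).1.
  rewrite sub0r normrN ger0_norm ?opnorm_ge0// => small.
  exists (fun n => B_ j (vpath s n)); first exact: (GB j).2.
  apply: typicalT => n; rewrite nrmB (le_trans (le_opnorm _ bd))//.
  apply: (@le_trans _ _ (eps / (M + 1) * M)).
    by rewrite ler_pM ?opnorm_ge0 ?nrm_ge0// ltW.
  by rewrite -mulrA ler_piMr ?(ltW eps0)// mulrC ler_pdivrMr// mul1r lerDl.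
- split=> // s; exact: (approx_vpath s.+1).
- by split=> // s; exact: approx_adjoint.
Qed.

Context (q_infty : forall j, (j <= q j)%N).

(** Let [u n] be a combination of the paths from [n] approximating [K (vpath s n)]
    for all typical [n].  Along [q] it is small since [K] is compact and [q j]
    tends to infinity; its norm is a continuous function of the outweights, so it
    is small at [a] too. *)
Lemma compact_Cstar_vpath0 K s : Cstar dot T K -> compact_op H K -> K (vpath s a) = 0.
Proof.
move=> SK cK; apply/eqP; rewrite -nrm_eq0; apply/eqP/le_anti; rewrite nrm_ge0 andbT.
apply/ler_addgt0Pr => eps eps0; rewrite add0r.
have e3 : 0 < eps / 3 by rewrite divr_gt0.
have [c [N /(_ N (leqnn _)) [ha hq]]] := Cstar_approx SK s e3.
set u := fun n => \sum_(k < N) c k *: vpath k n in ha hq.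
have [M M0 vM] := nrm_vpath_bounded s.
have Kv0 : \forall j \near \oo, nrm (K (vpath s (q j))) <= eps / 3.
  have M1 : 0 < M + 1 by rewrite ltr_wpDl.
  have eM : 0 < eps / 3 / (M + 1) by rewrite divr_gt0.
  have [n0 _ hn0] := compact_e_small hdot he cK eM.
  exists n0 => // j /= n0j.
  have /hn0 h : (n0 <= q j + s)%N by rewrite (leq_trans n0j)// (leq_trans (q_infty j))// leq_addr.
  have := vM (q j); rewrite vpathE (linZ _ _ (bounded_linear cK.1)) !nrmZ.
  rewrite (nrm_e hdot he) mulr1 => pM.
  apply: (@le_trans _ _ (M * (eps / 3 / (M + 1)))).
    by rewrite ler_pM ?nrm_ge0// ltW.
  by rewrite mulrCA ler_piMr ?(ltW e3)// ler_pdivrMr// mul1r lerDl.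
have uq : (fun j => nrm (u (q j)) ^+ 2) @ \oo --> nrm (u a) ^+ 2.
  rewrite nrm_sum_vpath; under eq_fun do rewrite nrm_sum_vpath.
  apply: (cvg_sum_ord (f := fun k j => nrm (c k) ^+ 2 * outweight x k (q j))
     (a := fun k => nrm (c k) ^+ 2 * outweight x k a)) => k _.
  by apply: cvgM; [exact: cvg_cst|exact: q_out].
have ua : nrm (u a) ^+ 2 <= (eps / 3 + eps / 3) ^+ 2.
  apply: (ler_cvg_to uq (cvg_cst _)); move: hq Kv0; apply: filterS2 => j hj Kj.
  rewrite ler_sqr ?nnegrE ?nrm_ge0 ?addr_ge0 ?(ltW e3)//.
  rewrite -[u (q j)](subrK (K (vpath s (q j)))) (le_trans (ler_nrmD _ _))//.
  by rewrite nrmB lerD.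
rewrite ler_sqr ?nnegrE ?nrm_ge0 ?addr_ge0 ?(ltW e3)// in ua.
rewrite -(subrK (u a) (K (vpath s a))) (le_trans (ler_nrmD _ _))//.
by have := lerD ha ua; rewrite -/(u a); lra.
Qed.

End RecurrentVertex.

(** * Criteria in terms of the weights *)

Section ShiftAlgebraCriteria.
Context (R : realType) (H : completeNormedModType R[i]).
Context (dot : {dot H for (@Num.conj R[i])}) (hdot : hilbert_inner_product dot).
Context (e : nat -> H) (he : orthonormal_basis dot e).
Context (x : nat -> R) (x_ge0 : forall n, 0 <= x n).
Context (T : H -> H) (bT : bounded_op H T) (Te : forall n, T (e n) = (x n)%:C *: e n.+1).

Lemma not_isolated_recurrent a : inweight x a = 0 -> ~ isolated x a ->
  exists q : nat -> nat, [/\ forall j, (j <= q j)%N,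
    (fun j => inweight x (q j)) @ \oo --> (0 : R) &
    forall i, (fun j => outweight x i (q j)) @ \oo --> outweight x i a].
Proof.
move=> xa0 niso.
have /choice[q hq] : forall j, exists n, (j <= n)%N /\ discrepancy x a j n < j.+1%:R^-1.
  move=> j; apply: contrapT => h; apply: niso; split=> //.
  exists j, j, j => n jn; rewrite leNgt; apply/negP => hn; apply: h.
  by exists n.
exists q; split=> [j||i]; first exact: (hq j).1.
  apply: (squeeze_cvgr _ (cvg_cst 0) (@cvg_harmonic R)); apply: nearW => j.
  rewrite inweight_ge0/= (le_trans (discrepancy_le_in x a j _))//.
  exact: ltW (hq j).2.
apply/cvgrPdist_lt => eps eps0.
have /cvgrPdist_lt/(_ _ (exprn_gt0 2 eps0)) := @cvg_harmonic R.
apply: filterS2 (nbhs_infty_gt i) => j ij; rewrite sub0r normrN ger0_norm ?harmonic_ge0// => small.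
rewrite -ltr_sqr ?nnegrE ?(ltW eps0)// real_normK ?num_real//.
rewrite -sqrrN opprB (le_lt_trans _ small)//.
by rewrite (le_trans (discrepancy_le_out x a _ ij))// ltW// (hq j).2.
Qed.

(** The initial vertex [a] of the component of [n] is the last one up to [n] with
    zero inweight; all weights from [a] to [n] are nonzero. *)
Lemma vertex_reached n : exists a s c,
  [/\ inweight x a = 0, c != 0 & vpath e T s a = c *: e n].
Proof.
elim: n => [|n [a [s [c [xa0 c0 vE]]]]].
  by exists 0%N, 0%N, 1; rewrite oner_neq0 scale1r.
have [xn0|xn0] := eqVneq (x n) 0.
  by exists n.+1, 0%N, 1; rewrite oner_neq0 scale1r /= xn0 expr0n.
exists a, s.+1, (c * (x n)%:C); split=> //; first by rewrite mulf_neq0// fmorph_eq0.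
by rewrite /vpath iterS -/(vpath e T s a) vE (linZ _ _ (bounded_linear bT)) Te scalerA.
Qed.

Theorem Cstar_meets_compacts :
  Cstar dot T `&` compact_op H <> [set (fun=> 0)] <-> exists a, isolated x a.
Proof.
split=> [|[a iso] E].
  apply: contra_notP => niso; apply/seteqP; split=> [K [SK cK]|_ ->]; last first.
    by split; [case: (Cstar_is_subalgebra dot bT)|exact: compact_op0].
  apply: (op_ext he cK.1 (bounded_op0 H)) => n.
  have [a [s [c [xa0 c0 vE]]]] := vertex_reached n.
  have [|q [qj qin qout]] := not_isolated_recurrent xa0.
    by move=> iso; apply: niso; exists a.
  have := compact_Cstar_vpath0 hdot he x_ge0 bT Te xa0 qin qout qj s SK cK.
  rewrite vE (linZ _ _ (bounded_linear cK.1)) => /eqP.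
  by rewrite scaler_eq0 (negbTE c0) => /eqP.
have [T' bT' TT'] := adjoint_exists hdot he bT.
have [P [SP cP Pa _]] := isolated_projection hdot he x_ge0 bT Te bT' TT' iso.
have : [set (fun=> 0)] P by rewrite -E.
move=> /= P0; have := nrm_e hdot he a.
by rewrite -Pa P0 nrm0 => /eqP; rewrite eq_sym oner_eq0.
Qed.

Theorem Cstar_contains_compacts :
  compact_op H `<=` Cstar dot T <-> (forall n, 0 < x n) /\ exists a, isolated x a.
Proof.
split=> [KS|[xgt0 [a iso]]].
  split; first exact: (compact_sub_Cstar_weight_gt0 hdot he x_ge0 bT Te).
  apply/Cstar_meets_compacts; rewrite setIidr// => E.
  have : [set (fun=> 0)] (fun y => dot y (e 0) *: e 0).
    by rewrite -E; exact: compact_rank_one.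
  move=> /= /(congr1 (fun f => f (e 0))); rewrite (dot_e he) eqxx scale1r => e00.
  by have := nrm_e hdot he 0; rewrite e00 nrm0 => /eqP; rewrite eq_sym oner_eq0.
apply: (compact_sub_Cstar hdot he x_ge0 bT Te xgt0).
case: a iso => [//|a] -[/= /eqP]; rewrite sqrf_eq0 => /eqP xa0.
by have := xgt0 a; rewrite xa0 ltxx.
Qed.

End ShiftAlgebraCriteria.

(** * Independent events and measurability *)

Section IndependentEvents.
Context (d : measure_display) (Omega : measurableType d) (R : realType).
Context (P : probability Omega R) (A : nat -> set Omega).
Context (mA : forall l, measurable (A l)) (p : R).
Context (PA : forall J : seq nat, uniq J -> P (\big[setI/setT]_(l <- J) A l) = (p ^+ size J)%:E).

(** By induction on [L], removing [A (N + L)] by inclusion and exclusion; the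
    intersection over [J] is carried along to absorb that event. *)
Lemma prob_avoid (N L : nat) (J : seq nat) : uniq J -> {in J, forall l, (N + L <= l)%N} ->
  P (\big[setI/setT]_(l <- J) A l `&` \big[setI/setT]_(i < L) ~` A (N + i)%N) =
  (p ^+ size J * (1 - p) ^+ L)%:E.
Proof.
have mJ (K : seq nat) : measurable (\big[setI/setT]_(l <- K) A l).
  exact: bigsetI_measurable.
elim: L J => [|L IHL] J uJ NJ; first by rewrite big_ord0 setIT PA// mulr1.
have mC : measurable (\big[setI/setT]_(i < L) ~` A (N + i)%N).
  by apply: bigsetI_measurable => i _; exact: measurableC.
rewrite big_ord_recr /= setIA -setDE measureD//; last 2 first.
  exact: measurableI.
  by rewrite (le_lt_trans (probability_le1 _ _)) ?ltry//; exact: measurableI.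
have IH1 := IHL J uJ (fun l lJ => ltnW (eq_ind _ (fun n => n <= l)%N (NJ l lJ) _ (addnS N L))).
have IH2 : P (\big[setI/setT]_(l <- J) A l `&` \big[setI/setT]_(i < L) ~` A (N + i)%N
    `&` A (N + L)%N) = (p ^+ (size J).+1 * (1 - p) ^+ L)%:E.
  have NLJ : (N + L)%N \notin J by apply/negP => /NJ; rewrite addnS ltnn.
  rewrite setIAC [X in X `&` _]setIC -(big_cons setT setI (N + L)%N J xpredT A)/=.
  apply: (IHL ((N + L)%N :: J)); first by rewrite /= NLJ.
  by move=> l; rewrite inE => /predU1P[->//|/NJ]; rewrite addnS => /ltnW.
rewrite [X in (X - _)%E]IH1 [X in (_ - X)%E]IH2.
by rewrite -EFinB /= exprS [(1 - p) ^+ L.+1]exprS; congr (_%:E); ring.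
Qed.

(** The probability of avoiding [L] of the events is [(1 - p) ^+ L]. *)
Lemma prob_eventually_avoid N : 0 < p -> p <= 1 ->
  P.-negligible [set w | forall l, (N <= l)%N -> ~ A l w].
Proof.
move=> p0 p1.
have mC L : measurable (\big[setI/setT]_(i < L) ~` A (N + i)%N).
  by apply: bigsetI_measurable => i _; exact: measurableC.
exists (\bigcap_L \big[setI/setT]_(i < L) ~` A (N + i)%N); split.
- exact: bigcapT_measurable.
- apply/eqP; rewrite eq_le measure_ge0 andbT.
  have PL L : (P (\bigcap_L \big[setI/setT]_(i < L) ~` A (N + i)%N) <= ((1 - p) ^+ L)%:E)%E.
    rewrite -[X in (_ <= X%:E)%E]mul1r -(expr0 p) -(@prob_avoid N L [::])//.
    rewrite big_nil setTI le_measure ?inE//; first exact: bigcapT_measurable.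
    by move=> w /(_ L I).
  have PF : P (\bigcap_L \big[setI/setT]_(i < L) ~` A (N + i)%N) \is a fin_num.
    by rewrite fin_num_measure//; exact: bigcapT_measurable.
  rewrite -(fineK PF) lee_fin.
  have lim : (fun L => (1 - p) ^+ L) @ \oo --> (0 : R).
    by apply: cvg_expr; rewrite ger0_norm ?subr_ge0// ltrBlDr ltrDl.
  apply: (ler_cvg_to (cvg_cst _) lim); apply: nearW => L.
  by rewrite -lee_fin fineK.
- move=> w wA L _; rewrite -(bigcap_mkord L (fun i => ~` A (N + i)%N)) => i _ /=.
  by apply: wA; rewrite leq_addr.
Qed.

End IndependentEvents.

Section RandomWeights.
Context (d : measure_display) (Omega : measurableType d) (R : realType).
Context (P : probability Omega R) (X : nat -> {RV P >-> R}).

Let x (w : Omega) (n : nat) : R := X n w.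

Lemma measurable_discrepancy a k n : measurable_fun setT (fun w => discrepancy (x w) a k n).
Proof.
have mX2 m : measurable_fun setT (fun w => x w m ^+ 2).
  exact: measurable_funX.
have mo i m : measurable_fun setT (fun w => outweight (x w) i m).
  by apply: measurable_prod => j _.
apply: measurable_funD; first by case: n => [|n] /=; [exact: measurable_cst|exact: mX2].
apply: measurable_sum => i; apply: measurable_funX; apply: measurable_funB; exact: mo.
Qed.

Lemma measurable_exists (Q : nat -> set Omega) : (forall n, measurable (Q n)) ->
  measurable [set w | exists n, Q n w].
Proof.
move=> mQ; have := bigcupT_measurable Q mQ; congr (measurable _).
by apply/seteqP; split=> w /= [n]; [move=> _|] => Qn; exists n.
Qed.

Lemma measurable_forall (Q : nat -> set Omega) : (forall n, measurable (Q n)) ->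
  measurable [set w | forall n, Q n w].
Proof.
move=> mQ; have := bigcapT_measurable mQ; congr (measurable _).
by apply/seteqP; split=> w /= Qw n; [exact: Qw|move=> _; exact: Qw].
Qed.

Lemma measurable_isolated : measurable [set w | exists a, isolated (x w) a].
Proof.
apply: measurable_exists => a.
apply: (measurableI [set w | inweight (x w) a = 0] [set w | exists k m N,
    forall n, (N <= n)%N -> m.+1%:R^-1 <= discrepancy (x w) a k n]).
  case: a => [|a].
    have -> : [set w | inweight (x w) 0 = 0] = setT by apply/seteqP; split.
    exact: measurableT.
  have /(_ measurableT [set 0]) : measurable_fun setT (fun w => x w a ^+ 2).
    exact: measurable_funX.
  by rewrite setTI; apply; exact: measurable_set1.
apply: measurable_exists => k; apply: measurable_exists => m.
apply: measurable_exists => N; apply: measurable_forall => n.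
have [Nn|Nn] := leqP N n; last first.
  have -> : (fun w => false -> m.+1%:R^-1 <= discrepancy (x w) a k n) = setT.
    by apply/seteqP; split.
  exact: measurableT.
have := measurable_fun_le measurableT (@measurable_cst _ _ Omega R setT m.+1%:R^-1)
  (measurable_discrepancy a k n).
by rewrite setTI; congr measurable; apply/seteqP; split=> w /=; [|exact].
Qed.

Lemma measurable_weights_gt0 : measurable [set w | forall n, 0 < x w n].
Proof.
apply: measurable_forall => n.
have := @measurable_funPTI _ _ _ _ (X n) _ (measurable_itv `]0, +oo[).
by congr measurable; apply/seteqP; split=> w /=; rewrite in_itv /= andbT.
Qed.

End RandomWeights.

(** * Recurrence of patterns in an i.i.d. sequence *)

Section Recurrence.
Context {R : realType}.

(** Along a sequence of vertices preceded by a weight tending to 0 and followed by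
    weights converging to those after [a], the discrepancy from [a] tends
    to 0, as it is a polynomial in these weights. *)
Lemma recurrent_not_isolated (x : nat -> R) a : (forall n, 0 <= x n) ->
  (forall k m N, exists n, [/\ (N <= n)%N, x n < m.+1%:R^-1 &
     forall j, (j < k)%N -> `|x (n.+1 + j)%N - x (a + j)%N| < m.+1%:R^-1]) ->
  ~ isolated x a.
Proof.
move=> x0 rec [_ [k [m [N far]]]].
have /choice[q hq] : forall i, exists n, [/\ (N <= n)%N, x n < i.+1%:R^-1 &
    forall j, (j < k)%N -> `|x (n.+1 + j)%N - x (a + j)%N| < i.+1%:R^-1].
  by move=> i; exact: rec.
have xq : (fun i => x (q i)) @ \oo --> (0 : R).
  apply: (squeeze_cvgr _ (cvg_cst 0) (@cvg_harmonic R)); apply: nearW => i.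
  by have [_ /ltW h _] := hq i; rewrite x0.
have xqj j : (j < k)%N -> (fun i => x ((q i).+1 + j)%N) @ \oo --> x (a + j)%N.
  move=> jk; apply/cvgrPdist_lt => eps eps0.
  have /cvgrPdist_lt/(_ _ eps0) := @cvg_harmonic R; apply: filterS => i.
  rewrite sub0r normrN ger0_norm ?harmonic_ge0// => small.
  by have [_ _ /(_ _ jk) h] := hq i; rewrite distrC (lt_trans h).
have wq i : (i <= k)%N ->
    (fun l => outweight x i (q l).+1) @ \oo --> outweight x i a.
  move=> ik; apply: (cvg_prod_ord (f := fun j l => x ((q l).+1 + j)%N ^+ 2)
    (a := fun j => x (a + j)%N ^+ 2)) => j ji.
  by rewrite expr2; under eq_fun do rewrite expr2; apply: cvgM; apply: xqj; exact: leq_trans ik.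
have dq : (fun l => discrepancy x a k (q l).+1) @ \oo --> (0 : R).
  have -> : (0 : R) = 0 * 0 + \sum_(i < k) (outweight x i a - outweight x i a) ^+ 2.
    by rewrite mulr0 add0r big1// => i _; rewrite subrr expr0n.
  apply: cvgD; first by rewrite /=; under eq_fun do rewrite expr2; exact: cvgM.
  apply: (cvg_sum_ord (f := fun i l => (outweight x i (q l).+1 - outweight x i a) ^+ 2)
    (a := fun i => (outweight x i a - outweight x i a) ^+ 2)) => i ik.
  rewrite expr2; under eq_fun do rewrite expr2.
  by apply: cvgM; apply: cvgB; (try exact: cvg_cst); apply: wq; exact: ltnW.
have : (m.+1%:R^-1 : R) <= 0.
  apply: (ler_cvg_to (cvg_cst _) dq); apply: nearW => l.
  by apply: far; have [Nq _ _] := hq l; exact: leqW.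
by rewrite leNgt invr_gt0 ltr0Sn.
Qed.

Definition cell m z : set R := `[z%:R / m.+1%:R, z.+1%:R / m.+1%:R[%classic.

Lemma measurable_cell m z : measurable (cell m z).
Proof. exact: measurable_itv. Qed.

Lemma mem_cell m (y : R) : 0 <= y -> cell m (Num.truncn (y * m.+1%:R)) y.
Proof.
move=> y0; rewrite /cell /= in_itv /= ler_pdivrMr// ltr_pdivlMr//.
by rewrite truncn_itv// mulr_ge0.
Qed.

Lemma cell_close m z (y y' : R) : cell m z y -> cell m z y' -> `|y - y'| < m.+1%:R^-1.
Proof.
rewrite /cell /= !in_itv /= => /andP[h1 h2] /andP[h3 h4].
have E : z.+1%:R / m.+1%:R = z%:R / m.+1%:R + m.+1%:R^-1 :> R.
  by rewrite -natr1 mulrDl mul1r.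
rewrite {}E in h2 h4; move: (z%:R / m.+1%:R : R) (m.+1%:R^-1 : R) h1 h2 h3 h4 => u v h1 h2 h3 h4.
by rewrite ltr_norml; apply/andP; split; lra.
Qed.

End Recurrence.

Section IidWeights.
Context (d : measure_display) (Omega : measurableType d) (R : realType).
Context (P : probability Omega R) (X : nat -> {RV P >-> R}).
Context (X_ge0 : forall n w, 0 <= X n w).
Context (X_independent : mutually_independent X).
Context (X_identically_distributed : identically_distributed X).

Let x (w : Omega) (n : nat) : R := X n w.
Let law (B : set R) : R := fine (P (X 0%N @^-1` B)).

Lemma prob_preimage n B : measurable B -> P (X n @^-1` B) = (law B)%:E.
Proof.
move=> mB; rewrite /law fineK; last by rewrite fin_num_measure//; exact: measurable_funPTI.
exact: (X_identically_distributed n 0 mB).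
Qed.

Lemma law_ge0 B : 0 <= law B.
Proof. exact: fine_ge0. Qed.

Lemma law_le1 B : measurable B -> law B <= 1.
Proof.
by move=> mB; rewrite -lee_fin -(prob_preimage 0 mB) probability_le1//; exact: measurable_funPTI.
Qed.

Lemma negligible_exists (Q : nat -> set Omega) : (forall n, P.-negligible (Q n)) ->
  P.-negligible [set w | exists n, Q n w].
Proof.
move=> nQ; apply: negligibleS (negligible_bigcup nQ) => w [n Qn].
by exists n.
Qed.

(** Indices are grouped in consecutive blocks of length [k.+1], which makes the
    windows independent. *)
Definition window k (B : nat -> set R) l : set Omega :=
  [set w | forall j, (j < k.+1)%N -> B j (x w (l * k.+1 + j)%N)].

Lemma measurable_window k B l : (forall j, measurable (B j)) -> measurable (window k B l).
Proof.
move=> mB; apply: measurable_forall => j.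
have [jk|jk] := ltnP j k.+1; last first.
  have -> : (fun w => false -> B j (x w (l * k.+1 + j)%N)) = setT.
    by apply/seteqP; split.
  exact: measurableT.
have := @measurable_funPTI _ _ _ _ (X (l * k.+1 + j)%N) _ (mB j).
by congr measurable; apply/seteqP; split=> w /=; [|exact].
Qed.

(** An intersection of windows constrains each index at most once: the index [n]
    is constrained by the set [B (n %% k.+1)]. *)
Lemma prob_windows k B (J : seq nat) : (forall j, measurable (B j)) -> uniq J ->
  P (\big[setI/setT]_(l <- J) window k B l) =
  ((\prod_(j < k.+1) law (B j)) ^+ size J)%:E.
Proof.
move=> mB uJ; pose s := [seq (l * k.+1 + j)%N | l <- J, j <- index_iota 0 k.+1].
have us : uniq s.
  apply: allpairs_uniq => //; first exact: iota_uniq.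
  move=> [l j] [l' j'] /allpairsPdep[? [? [_ h [-> ->]]]] /allpairsPdep[? [? [_ h' [-> ->]]]] /= E.
  rewrite !mem_index_iota /= in h h'.
  have := congr1 (fun n => n %% k.+1)%N E; have := congr1 (fun n => n %/ k.+1)%N E.
  by rewrite !divnMDl// !modnMDl !divn_small// !modn_small// !addn0 => -> ->.
have [F memF permF] : exists2 F : {fset nat}, F =i s & perm_eq F s.
  exists (seq_fset tt s); first exact: seq_fsetE.
  by rewrite -[X in perm_eq _ X](undup_id us); exact: seq_fset_perm.
have -> : \big[setI/setT]_(l <- J) window k B l =
    \bigcap_(n in [set` F]) (X n @^-1` B (n %% k.+1)%N).
  rewrite -bigcap_seq; apply/seteqP; split=> w wJ.
    move=> n /=; rewrite memF => /allpairsP[[l j] /= [lJ]].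
    rewrite mem_index_iota /= => jk ->; rewrite modnMDl modn_small//.
    exact: wJ.
  move=> l /= lJ j jk.
  have /wJ /= : [set` F] (l * k.+1 + j)%N.
    rewrite /= memF; apply/allpairsP; exists (l, j) => /=.
    by rewrite mem_index_iota.
  by rewrite modnMDl modn_small.
rewrite (X_independent _ (fun n => mB (n %% k.+1)%N)).
under eq_bigr do rewrite prob_preimage//.
rewrite -(big_morph EFin (@EFinM R) erefl); congr (_%:E).
rewrite (perm_big _ permF) /= big_allpairs_dep /=.
under eq_bigr => l _.
  rewrite big_nat.
  under eq_bigr => j /andP[_ jk] do rewrite modnMDl modn_small//.
  rewrite -big_nat big_mkord.
  over.
by rewrite big_const_seq count_predT; elim: (size J) => //= n ->; rewrite exprS.
Qed.

Lemma pattern_recurs k B N : (forall j, measurable (B j)) ->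
  (forall j, (j < k.+1)%N -> 0 < law (B j)) ->
  P.-negligible [set w | forall l, (N <= l)%N -> ~ window k B l w].
Proof.
move=> mB Bgt0.
apply: (@prob_eventually_avoid _ _ _ P (window k B) _ (\prod_(j < k.+1) law (B j))).
- by move=> l; exact: measurable_window.
- by move=> J; exact: prob_windows.
- by apply: prodr_gt0 => j _; exact: Bgt0.
- by apply: prodr_ile1 => j _; rewrite law_ge0 law_le1.
Qed.

Definition nonrecurrent a k m N : set Omega := [set w | ~ exists n,
  [/\ (N <= n)%N, x w n < m.+1%:R^-1 &
   forall j, (j < k)%N -> `|x w (n.+1 + j)%N - x w (a + j)%N| < m.+1%:R^-1]].

(** Split according to the cells of size [1 / m.+1] that contain the weights at
    [a, ..., a + k - 1]; such cells are listed by a sequence of naturals, so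
    there are countably many cases.  If one of the cells has probability 0, the
    case is negligible.  Otherwise the pattern formed by a weight in the ball
    around 0, of positive probability by assumption, followed by weights in these
    cells recurs almost surely, which contradicts nonrecurrence. *)
Lemma nonrecurrent_negligible a k m N : essran (X 0%N) 0 ->
  P.-negligible (nonrecurrent a k m N).
Proof.
move=> ess0.
pose code v := odflt [::] (@choice.unpickle (seq nat) v).
pose F v := [set w | (forall j, (j < k)%N -> cell m (nth 0%N (code v) j) (x w (a + j)%N)) /\
   nonrecurrent a k m N w].
apply: (@negligibleS _ _ _ P [set w | exists v, F v w]).
  move=> w bad; exists (choice.pickle [seq Num.truncn (x w (a + j)%N * m.+1%:R) | j <- iota 0 k]).
  split=> // j jk; rewrite /code choice.pickleK /= (nth_map 0%N) ?size_iota// nth_iota//.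
  exact/mem_cell/X_ge0.
apply: negligible_exists => v; set s := code v.
have [[j [jk c0]]|pos] := pselect (exists j, (j < k)%N /\ law (cell m (nth 0%N s j)) = 0).
  exists (X (a + j)%N @^-1` cell m (nth 0%N s j)); split.
  - by apply: measurable_funPTI; exact: measurable_cell.
  - by rewrite prob_preimage ?c0//; exact: measurable_cell.
  - by move=> w [+ _] => /(_ j jk).
pose B j := if j is j'.+1 then cell m (nth 0%N s j') else ball (0 : R) m.+1%:R^-1.
have mB j : measurable (B j).
  by case: j => [|j] /=; [exact: measurable_ball|exact: measurable_cell].
have Bgt0 j : (j < k.+1)%N -> 0 < law (B j).
  case: j => [|j] jk /=.
    rewrite -lte_fin -(prob_preimage 0 (mB 0%N)); apply: ess0.
    by rewrite invr_gt0.
  by rewrite lt_neqAle law_ge0 andbT eq_sym; apply/eqP => c0; apply: pos; exists j.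
apply: negligibleS (pattern_recurs N mB Bgt0) => w [wcell bad] l Nl wl.
apply: bad; exists (l * k.+1)%N; split.
- by rewrite (leq_trans Nl)// leq_pmulr.
- have := wl 0%N (ltn0Sn _); rewrite /B /ball /= sub0r normrN addn0.
  exact/le_lt_trans/ler_norm.
- move=> j jk; apply: cell_close (wcell j jk).
  by have := wl j.+1 jk; rewrite addSnnS.
Qed.

Lemma isolated_negligible : essran (X 0%N) 0 ->
  P.-negligible [set w | exists a, isolated (x w) a].
Proof.
move=> ess0; apply: (@negligibleS _ _ _ P
    [set w | exists a k m N, nonrecurrent a k m N w]); last first.
  by do 4![apply: negligible_exists => ?]; exact: nonrecurrent_negligible.
move=> w [a iso]; apply: contrapT => rec.
apply: recurrent_not_isolated iso; first by move=> n; exact: X_ge0.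
move=> k m N; apply: contrapT => bad; apply: rec.
by exists a, k, m, N.
Qed.

(** A ball around 0 of radius [r] has probability 0, so almost surely all weights
    are at least [r]. *)
Lemma weights_bounded_below : ~ essran (X 0%N) 0 ->
  P.-negligible (~` [set w | (forall n, 0 < x w n) /\ exists a, isolated (x w) a]).
Proof.
move=> ess0.
have [r [r0 br0]] : exists r : R, 0 < r /\ law (ball 0 r) = 0.
  apply: contrapT => h; apply: ess0 => r r0.
  have mb : measurable (ball (0 : R) r) by exact: measurable_ball.
  have -> : distribution P (X 0%N) (ball 0 r) = (law (ball 0 r))%:E.
    exact: (prob_preimage 0 mb).
  rewrite lte_fin lt_neqAle law_ge0 andbT eq_sym; apply/eqP => b0.
  by apply: h; exists r.
have mb : measurable (ball (0 : R) r) by exact: measurable_ball.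
apply: (@negligibleS _ _ _ P [set w | exists n, (X n @^-1` ball 0 r) w]); last first.
  apply: negligible_exists => n; exists (X n @^-1` ball 0 r); split=> //.
    exact: measurable_funPTI.
  by rewrite prob_preimage// br0.
move=> w bad; apply: contrapT => far; apply: bad.
have xr n : r <= x w n.
  rewrite leNgt; apply/negP => xn; apply: far; exists n.
  by rewrite /ball /= sub0r normrN ger0_norm.
split=> [n|]; first exact: lt_le_trans (xr n).
have r2 : 0 < r ^+ 2 by rewrite exprn_gt0.
(* With [k = 0], the discrepancy from the vertex 0 is the inweight. *)
exists 0%N; split=> //; exists 0%N, (Num.truncn (r ^+ 2)^-1), 1%N => -[//|n] _.
rewrite (le_trans _ (discrepancy_le_in _ _ _ _))//=.
apply: (@le_trans _ _ (r ^+ 2)); last first.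
  by rewrite ler_sqr ?nnegrE// ?(ltW r0)// (le_trans (ltW r0)).
rewrite -[leRHS]invrK lef_pV2 ?posrE ?invr_gt0//.
by rewrite ltW// truncnS_gt.
Qed.

End IidWeights.

Theorem theorem1p1 (R : realType)
  (H : completeNormedModType R[i]) (dot : {dot H for (@Num.conj R[i])})
  (hdot : hilbert_inner_product dot)
  (e : nat -> H) (he : orthonormal_basis dot e)
  (d : measure_display) (Omega : measurableType d) (P : probability Omega R)
  (X : nat -> {RV P >-> R})
  (X_ge0 : forall n w, 0 <= X n w)
  (X_bounded : forall n, bounded_fun (X n))
  (X_independent : mutually_independent X)
  (X_identically_distributed : identically_distributed X)
  (T : Omega -> H -> H) (hT : random_weighted_shift e X T) :
  let E1 := [set w | compact_op H `<=` Cstar dot (T w)] in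
  let E2 := [set w | Cstar dot (T w) `&` compact_op H <> [set (fun=> 0)]] in
  [/\ measurable E1, measurable E2, P E1 = P E2 &
      P E2 = if 0 \in essran (X 0%N) then 0%E else 1%E].
Proof.
move=> E1 E2.
have E2E : E2 = [set w | exists a, isolated (fun n => X n w) a].
  apply/seteqP; split=> w;
    have := Cstar_meets_compacts hdot he (X_ge0^~ w) (hT w).1 (hT w).2; case=> h1 h2.
    exact: h1.
  exact: h2.
have E1E : E1 = [set w | (forall n, 0 < X n w) /\ exists a, isolated (fun n => X n w) a].
  apply/seteqP; split=> w;
    have := Cstar_contains_compacts hdot he (X_ge0^~ w) (hT w).1 (hT w).2; case=> h1 h2.
    exact: h1.
  exact: h2.
have mE2 : measurable E2 by rewrite E2E; exact: measurable_isolated.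
have mE1 : measurable E1.
  rewrite E1E; apply: measurableI; first exact: measurable_weights_gt0.
  exact: measurable_isolated.
have E12 : E1 `<=` E2 by rewrite E1E E2E => w [].
suff PE : (0 \in essran (X 0%N) -> P E2 = 0%E) /\ (0 \notin essran (X 0%N) -> P E1 = 1%E).
  case: ifPn => [/PE.1 PE2|/PE.2 PE1]; split=> //.
    apply/eqP; rewrite PE2 eq_le measure_ge0 andbT -PE2.
    by rewrite le_measure ?inE.
  by apply/eqP; rewrite PE1 eq_le probability_le1// -PE1 le_measure ?inE.
  by apply/eqP; rewrite eq_le probability_le1//= -PE1 le_measure ?inE.
split=> [/set_mem ess0|/negP ess0].
  apply/negligibleP => //; rewrite E2E; exact: isolated_negligible.
have : P.-negligible (~` E1).
  by rewrite E1E; apply: weights_bounded_below => // ?; apply: ess0; exact/mem_set.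
move/negligibleP => /(_ (measurableC mE1)) PC.
by rewrite -(setCK E1) probability_setC ?PC ?sube0//; exact: measurableC.
Qed.
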